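(* Let $X$ be a complex manifold and let $(E,h) \to X$ be a Griffiths semipositive Hermitian holomorphic vector bundle of rank $3$. Then the Schur form $c_1(E,h) \wedge c_2(E,h) - c_3(E,h)$ is a positive $(3,3)$-form on $X$.
   Context: For a Hermitian holomorphic vector bundle $(E,h)$ of rank $r$ over a complex manifold $X$, let $\Theta(E,h) \in \mathcal{A}^{1,1}(X,\operatorname{End}(E))$ be its Chern curvature tensor. The Chern forms are $c_k(E,h) = \operatorname{tr}_{\operatorname{End}(\Lambda^k E)}\left( \Lambda^k \frac{i}{2\pi}\Theta(E,h)\right)$ for $0 \le k \le r$ (a real $(k,k)$-form on $X$ representing the Chern class $c_k(E)$). $(E,h)$ is called Griffiths semipositive if for every $x\in X$, $v\in E_x$, $\tau\in T_{X,x}$ one has $\langle\Theta(E,h)_x\cdot v,v\rangle_h(\tau,\bar\tau)\ge 0$. Positivity of forms: let $V$ be a complex vector space of dimension $n$ with basis $(e_1,\dots,e_n)$ and dual basis $(e_1^\vee,\dots,e_n^\vee)$. A form $\nu\in\Lambda^{n,n}V^\vee$ is a positive volume form if $\nu = t\, i e_1^\vee\wedge\overline{e}_1^\vee\wedge\dots\wedge i e_n^\vee\wedge\overline{e}_n^\vee$ for some real $t\ge 0$ (independent of the basis). A real form $u$ of bidegree $(p,p)$ on $V$ is called positive if, with $q=n-p$, for every decomposable $\beta=\beta_1\wedge\dots\wedge\beta_q$ with $\beta_1,\dots,\beta_q\in V^\vee$, the form $u\wedge i^{q^2}\beta\wedge\bar\beta$ is a positive volume form. A real $(p,p)$-form on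 $X$ is positive if it is positive on $V=T_{X,x}$ for every $x\in X$. (So positivity is meant in the weak, non-strict sense.) *)

(* Defs.v *)
From HB Require Import structures.
From mathcomp Require Import all_boot all_order all_algebra all_fingroup.
From mathcomp Require Import all_classical all_reals all_analysis.
From mathcomp Require Import complex sesquilinear.

Set Implicit Arguments.
Unset Strict Implicit.
Unset Printing Implicit Defensive.

Import Order.TTheory GRing.Theory Num.Theory numFieldNormedType.Exports.

Local Open Scope classical_set_scope.
Local Open Scope complex_scope.
Local Open Scope ring_scope.

(* [C^n] is ['rV[R[i]^o]_n]: the [^o] gives access to the normed topology
   that MathComp-Analysis puts on a numFieldType. *)

(** * Differential calculus on open subsets of [C^n] *)

(* [differentiable] is Fréchet differentiability over the scalar field, which
   is [R[i]] here: this is complex differentiability. *)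
Definition holomorphic_on (R : realType) (n : nat) (V : normedModType R[i])
    (U : set 'rV[R[i]^o]_n) (f : 'rV[R[i]^o]_n -> V) : Prop :=
  forall z, U z -> differentiable f z.

(* Derivatives of complex-valued functions along real lines [t |-> z + t v],
   [t : R], taken on real and imaginary parts. *)
Definition real_derivable (R : realType) (n : nat)
    (f : 'rV[R[i]^o]_n -> R[i]^o) (v z : 'rV[R[i]^o]_n) : Prop :=
  derivable (fun t : R => complex.Re (f (z + t%:C *: v))) 0 1 /\
  derivable (fun t : R => complex.Im (f (z + t%:C *: v))) 0 1.

Definition real_derive (R : realType) (n : nat)
    (f : 'rV[R[i]^o]_n -> R[i]^o) (v z : 'rV[R[i]^o]_n) : R[i]^o :=
  derive1 (fun t : R => complex.Re (f (z + t%:C *: v))) 0 +i*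
  derive1 (fun t : R => complex.Im (f (z + t%:C *: v))) 0.

Fixpoint Ck_on (R : realType) (n k : nat) (U : set 'rV[R[i]^o]_n)
    (f : 'rV[R[i]^o]_n -> R[i]^o) : Prop :=
  (forall z, U z -> {for z, continuous f}) /\
  if k is k'.+1 then
    forall v, (forall z, U z -> real_derivable f v z) /\
              Ck_on k' U (real_derive f v)
  else True.

Definition smooth_on (R : realType) (n : nat) (U : set 'rV[R[i]^o]_n)
    (f : 'rV[R[i]^o]_n -> R[i]^o) : Prop :=
  forall k, Ck_on k U f.

(* Wirtinger derivatives
   [d/dz_j = (d/dx_j - i d/dy_j) / 2] and
   [d/d(conj z_j) = (d/dx_j + i d/dy_j) / 2]. *)
Definition del (R : realType) (n : nat) (j : 'I_n)
    (f : 'rV[R[i]^o]_n -> R[i]^o) (z : 'rV[R[i]^o]_n) : R[i]^o :=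
  2^-1 * (real_derive f (delta_mx 0 j) z
          - 'i * real_derive f ('i *: delta_mx 0 j) z).

Definition delbar (R : realType) (n : nat) (j : 'I_n)
    (f : 'rV[R[i]^o]_n -> R[i]^o) (z : 'rV[R[i]^o]_n) : R[i]^o :=
  2^-1 * (real_derive f (delta_mx 0 j) z
          + 'i * real_derive f ('i *: delta_mx 0 j) z).

Definition del_mx (R : realType) (n r : nat) (j : 'I_n)
    (F : 'rV[R[i]^o]_n -> 'M[R[i]]_r) (z : 'rV[R[i]^o]_n) : 'M[R[i]]_r :=
  \matrix_(a, b) del j (fun w => F w a b) z.

Definition delbar_mx (R : realType) (n r : nat) (j : 'I_n)
    (F : 'rV[R[i]^o]_n -> 'M[R[i]]_r) (z : 'rV[R[i]^o]_n) : 'M[R[i]]_r :=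
  \matrix_(a, b) delbar j (fun w => F w a b) z.

(** * Exterior algebra *)

(* The exterior algebra on generators [e_0, ..., e_(m-1)]; [w K] is the
   coefficient of [e_K = e_k1 /\ ... /\ e_kp], where [k1 < ... < kp] are the
   elements of [K]. *)
Definition ext (R : realType) (m : nat) := {ffun {set 'I_m} -> R[i]^o}.

Definition ext1 (R : realType) (m : nat) : ext R m :=
  [ffun K : {set 'I_m} => (K == finset.set0)%:R].

Definition ext_gen (R : realType) (m : nat) (k : 'I_m) : ext R m :=
  [ffun K : {set 'I_m} => (K == [set k]%SET)%:R].

(* [e_I /\ e_J = (-1) ^ shuffle_inv I J * e_(I :|: J)] for disjoint [I], [J] *)
Definition shuffle_inv (m : nat) (I J : {set 'I_m}) : nat :=
  #|[set p in finset.setX I J | (p.2 < p.1)%N]%SET|.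

Definition wedge (R : realType) (m : nat) (u v : ext R m) : ext R m :=
  [ffun K : {set 'I_m} =>
     \sum_(I : {set 'I_m} | I \subset K)
       (-1) ^+ shuffle_inv I (K :\: I)%SET * u I * v (K :\: I)%SET].

(** * Forms at a point: the complex exterior algebra of [V = C^n] *)

(* The generators are [dz_0, ..., dz_(n-1)] followed by their conjugates. *)
Definition dz (R : realType) (n : nat) (j : 'I_n) : ext R (n + n) :=
  ext_gen R (lshift n j).

Definition dzbar (R : realType) (n : nat) (j : 'I_n) : ext R (n + n) :=
  ext_gen R (rshift n j).

Definition conj_index (n : nat) (k : 'I_(n + n)) : 'I_(n + n) :=
  match fintype.split k with inl j => rshift n j | inr j => lshift n j end.

(* Complex conjugation: antilinear, multiplicative, exchanging [dz_j] and
   [dzbar_j]. *)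
Definition conj_form (R : realType) (n : nat) (w : ext R (n + n)) :
    ext R (n + n) :=
  \sum_(K : {set 'I_(n + n)})
    (Num.conj (w K) : R[i]) *:
      \big[@wedge R (n + n)/ext1 R (n + n)]_(k <- enum K)
        ext_gen R (conj_index k).

Definition has_bidegree (R : realType) (n p q : nat) (w : ext R (n + n)) :
    Prop :=
  forall K : {set 'I_(n + n)}, w K != 0 ->
    #|[set j : 'I_n | lshift n j \in K]%SET| = p /\
    #|[set j : 'I_n | rshift n j \in K]%SET| = q.

Definition positive_volume (R : realType) (n : nat) (w : ext R (n + n)) :
    Prop :=
  exists2 t : R, 0 <= t &
    w = t%:C *: \big[@wedge R (n + n)/ext1 R (n + n)]_(j < n)
                  ('i *: wedge (dz R j) (dzbar R j)).

(* The linear form on [C^n] with coefficients [b], as a form of type (1,0). *)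
Definition linear_form (R : realType) (n : nat) (b : 'rV[R[i]]_n) :
    ext R (n + n) :=
  \sum_(j < n) b 0 j *: dz R j.

(* For [n < p] the last clause is void, but then [w = 0] by bidegree. *)
Definition positive_form (R : realType) (n p : nat) (w : ext R (n + n)) :
    Prop :=
  [/\ has_bidegree p p w, conj_form w = w &
    forall q : nat, (p + q)%N = n -> forall beta : 'I_q -> 'rV[R[i]]_n,
      let b := \big[@wedge R (n + n)/ext1 R (n + n)]_(s < q)
                 linear_form (beta s) in
      positive_volume (wedge w ('i ^+ (q ^ 2)%N *: wedge b (conj_form b)))].

(* Matrices with entries in the (commuting) forms of even degree.
   [ext_power A f g] is the [(f, g)] entry of [Lambda^k A] in the basis
   [e_(f 0) /\ ... /\ e_(f (k-1))], [f] strictly increasing: the coefficient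
   of [e_f] in [A e_(g 0) /\ ... /\ A e_(g (k-1))]. *)
Definition ext_power (R : realType) (m r k : nat) (A : 'M[ext R m]_r)
    (f g : {ffun 'I_k -> 'I_r}) : ext R m :=
  \sum_(s : 'S_k)
    ((-1) ^+ s : R[i]) *:
      \big[@wedge R m/ext1 R m]_(l < k) A (f (s l)) (g l).

Definition tr_ext_power (R : realType) (m r k : nat) (A : 'M[ext R m]_r) :
    ext R m :=
  \sum_(f : {ffun 'I_k -> 'I_r} |
          [forall l1 : 'I_k, forall l2 : 'I_k,
             (l1 < l2)%N ==> (f l1 < f l2)%N])
    ext_power A f f.

(** * Complex manifolds *)

Record complexManifold (R : realType) (n : nat) := ComplexManifold {
  carrier :> topologicalType;
  carrier_hausdorff : hausdorff_space carrier;
  carrier_second_countable : @second_countable carrier;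
  atlas : Type;
  chart_dom : atlas -> set carrier;
  chart_cod : atlas -> set 'rV[R[i]^o]_n;
  chart : atlas -> carrier -> 'rV[R[i]^o]_n;
  chart_inv : atlas -> 'rV[R[i]^o]_n -> carrier;
  chart_dom_open : forall i, open (chart_dom i);
  chart_cod_open : forall i, open (chart_cod i);
  chart_cover : forall x, exists i, chart_dom i x;
  chart_to_cod : forall i x, chart_dom i x -> chart_cod i (chart i x);
  chart_inv_to_dom : forall i z, chart_cod i z -> chart_dom i (chart_inv i z);
  chartK : forall i x, chart_dom i x -> chart_inv i (chart i x) = x;
  chart_invK : forall i z, chart_cod i z -> chart i (chart_inv i z) = z;
  chart_continuous :
    forall i x, chart_dom i x -> {for x, continuous (chart i)};
  chart_inv_continuous :
    forall i z, chart_cod i z -> {for z, continuous (chart_inv i)};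
  chart_transition : forall i j,
    holomorphic_on (chart_cod i `&` chart_inv i @^-1` chart_dom j)
                   (chart j \o chart_inv i)
}.

(* Functions on an open subset [W] of [X], read in charts. *)
Definition holomorphic_fun (R : realType) (n : nat) (X : complexManifold R n)
    (W : set X) (f : X -> R[i]^o) : Prop :=
  forall i : atlas X,
    holomorphic_on (chart_cod i `&` chart_inv i @^-1` W) (f \o chart_inv i).

Definition smooth_fun (R : realType) (n : nat) (X : complexManifold R n)
    (W : set X) (f : X -> R[i]^o) : Prop :=
  forall i : atlas X,
    smooth_on (chart_cod i `&` chart_inv i @^-1` W) (f \o chart_inv i).

(** * Hermitian holomorphic vector bundles *)

(* The holomorphic structure is given by local frames with holomorphic
   transition matrices. *)
Record holVectorBundle (R : realType) (n : nat) (X : complexManifold R n)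
    (r : nat) := HolVectorBundle {
  fiber :> X -> vectType R[i];
  frames : Type;
  frame_dom : frames -> set X;
  frame : frames -> forall x : X, r.-tuple (fiber x);
  frame_dom_open : forall a, open (frame_dom a);
  frame_cover : forall x, exists a, frame_dom a x;
  frame_basis : forall a x, frame_dom a x -> basis_of fullv (frame a x);
  frame_transition : forall (a b : frames) (j k : 'I_r),
    holomorphic_fun (frame_dom a `&` frame_dom b)
      (fun x => coord (frame a x) j (tnth (frame b x) k))
}.

(* [h x u v] is linear in [u] and conjugate-linear in [v]. *)
Record hermitianMetric (R : realType) (n : nat) (X : complexManifold R n)
    (r : nat) (E : holVectorBundle X r) := HermitianMetric {
  metric :> forall x : X, {dot E x for Num.conj};
  metric_smooth : forall (a : frames E) (j k : 'I_r),
    smooth_fun (frame_dom a)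
      (fun x => metric x (tnth (frame a x) j) (tnth (frame a x) k))
}.

(** * Chern curvature *)

(* Everything below is computed at a point of [chart_dom i `&` frame_dom a],
   in the coordinates [z] of the chart [i] and in the frame [e] given by [a];
   tangent vectors and forms are expressed in the coordinates [z]. *)

Definition gram (R : realType) (n : nat) (X : complexManifold R n) (r : nat)
    (E : holVectorBundle X r) (h : hermitianMetric E) (i : atlas X)
    (a : frames E) (z : 'rV[R[i]^o]_n) : 'M[R[i]]_r :=
  \matrix_(k, j) h (chart_inv i z)
    (tnth (frame a (chart_inv i z)) j) (tnth (frame a (chart_inv i z)) k).

(* The Chern connection is [nabla e_b = \sum_a A_ab e_a] with
   [A = G^-1 (del G)], [G] the Gram matrix above; this is the [dz_j] part. *)
Definition chern_connection (R : realType) (n : nat) (X : complexManifold R n)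
    (r : nat) (E : holVectorBundle X r) (h : hermitianMetric E) (i : atlas X)
    (a : frames E) (j : 'I_n) (z : 'rV[R[i]^o]_n) : 'M[R[i]]_r :=
  invmx (gram h i a z) *m del_mx j (gram h i a) z.

(* [Theta = delbar A = \sum_(j, k) Theta_jk dz_j /\ dzbar_k]; the sign comes
   from [dzbar_k /\ dz_j = - dz_j /\ dzbar_k]. *)
Definition curvature_coef (R : realType) (n : nat) (X : complexManifold R n)
    (r : nat) (E : holVectorBundle X r) (h : hermitianMetric E) (i : atlas X)
    (a : frames E) (j k : 'I_n) (x : X) : 'M[R[i]]_r :=
  - delbar_mx k (chern_connection h i a j) (chart i x).

Definition curvature_form (R : realType) (n : nat) (X : complexManifold R n)
    (r : nat) (E : holVectorBundle X r) (h : hermitianMetric E) (i : atlas X)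
    (a : frames E) (x : X) : 'M[ext R (n + n)]_r :=
  \matrix_(b, c) \sum_(j < n) \sum_(k < n)
    curvature_coef h i a j k x b c *: wedge (dz R j) (dzbar R k).

(* [Theta_jk] as an endomorphism of the fiber. *)
Definition curvature_end (R : realType) (n : nat) (X : complexManifold R n)
    (r : nat) (E : holVectorBundle X r) (h : hermitianMetric E) (i : atlas X)
    (a : frames E) (j k : 'I_n) (x : X) (v : E x) : E x :=
  \sum_(b < r) \sum_(c < r)
    (curvature_coef h i a j k x b c * coord (frame a x) c v)
      *: tnth (frame a x) b.

(* [<Theta v, v>_h (tau, conj tau)
      = \sum_(j, k) <Theta_jk v, v>_h tau_j (conj tau_k)];
   in [R[i]], [0 <= w] means that [w] is real and nonnegative. *)
Definition griffiths_semipositive (R : realType) (n : nat)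
    (X : complexManifold R n) (r : nat) (E : holVectorBundle X r)
    (h : hermitianMetric E) : Prop :=
  forall (i : atlas X) (a : frames E) (x : X),
    chart_dom i x -> frame_dom a x ->
    forall (v : E x) (tau : 'rV[R[i]]_n),
      0 <= \sum_(j < n) \sum_(k < n)
             h x (curvature_end h i a j k v) v
             * (tau 0 j * Num.conj (tau 0 k)).

(** * Chern forms *)

Definition chern_form (R : realType) (n : nat) (X : complexManifold R n)
    (r : nat) (E : holVectorBundle X r) (h : hermitianMetric E) (k : nat)
    (i : atlas X) (a : frames E) (x : X) : ext R (n + n) :=
  tr_ext_power k
    (map_mx (fun w : ext R (n + n) => ('i / (2 * pi)%:C : R[i]) *: w)
       (curvature_form h i a x)).

(* Positivity at every point of a form given by its expressions in charts
   (and, as for Chern forms, possibly computed from a local frame). *)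
Definition positive_on_manifold (R : realType) (n : nat)
    (X : complexManifold R n) (r : nat) (E : holVectorBundle X r) (p : nat)
    (w : atlas X -> frames E -> X -> ext R (n + n)) : Prop :=
  forall (i : atlas X) (a : frames E) (x : X),
    chart_dom i x -> frame_dom a x -> positive_form p (w i a x).

(* Main.v *)
(** Everything happens at one point: Griffiths semipositivity makes the curvature a
    Hermitian tensor on [T (x) E], whose entries in an orthonormal frame form a 3x3 matrix
    [A] over the commutative ring of even forms.  There [c1 c2 - c3] is a positive
    combination of the forms [<A u, u> (<A u, u> <A v, v> - <A u, v> <A v, u>)], so it is
    enough to treat one pair [(u, v)].  Testing against [beta] restricts the four (1,1)-forms
    to a 3-dimensional space, where their products are mixed discriminants of 3x3
    matrices.  Diagonalising [<A u, u>] reduces the claim to [|k_i|^2 <= a_i b_i] (Griffiths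
    semipositivity along the i-th axis) and the arithmetic-geometric mean inequality. *)

Require Import Defs.
From HB Require Import structures.
From mathcomp Require Import all_boot all_order all_algebra all_fingroup.
From mathcomp Require Import all_classical all_reals all_analysis.
From mathcomp Require Import complex sesquilinear spectral zify ring.

Set Implicit Arguments.
Unset Strict Implicit.
Unset Printing Implicit Defensive.

Import Order.TTheory GRing.Theory Num.Theory.

Local Open Scope complex_scope.
Local Open Scope sesquilinear_scope.
Local Open Scope ring_scope.

(** * The exterior algebra *)

(** The hypothesis bounds the curvature only on decomposable tensors [tau (x) v], not on sums of
    such tensors. Each summand escapes this obstacle because its first factor [<A u, u>] is a
    nonnegative (1,1)-form, hence a sum of squares [i alpha /\ conj alpha]: in a basis adapted to
    it, off-diagonal entries of the other forms enter only as squared moduli, with the favourable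
    sign. The term [c3] displays no such factor, so [c1 c2 - c3] must be rewritten as a whole before
    any sign can be read off. The natural rewriting is an average over the unitary group. Vectors
    built from a cube root of unity turn it into a finite polynomial identity, valid in any
    commutative ring with such a root and checked by [ring]; this is why even forms are packaged as
    a commutative ring and why conjugates are carried as independent variables. The test covectors
    are arbitrary, so they are completed to a basis that need not be unitary. A coframe change acts
    by congruence, which preserves every hypothesis on the forms and multiplies the volume form by a
    squared modulus. *)

Section ExteriorAlgebra.
Variables (R : realType) (m : nat).
Implicit Types (u v w : ext R m) (I J K : {set 'I_m}).

Definition ext_mon K : ext R m := [ffun L : {set 'I_m} => (L == K)%:R].

Lemma ext_monE K L : ext_mon K L = (L == K)%:R.
Proof. by rewrite ffunE. Qed.

Lemma ext_sum_mon u : u = \sum_K u K *: ext_mon K.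
Proof.
apply/ffunP => L; rewrite sum_ffunE (bigD1 L) //= big1 ?addr0.
  by rewrite !ffunE eqxx /GRing.scale /= mulr1.
by move=> K KL; rewrite !ffunE eq_sym (negPf KL) scaler0.
Qed.

Lemma ext_ind (P : ext R m -> Prop) :
  P 0 -> (forall a u v, P u -> P v -> P (a *: u + v)) ->
  (forall K, P (ext_mon K)) -> forall u, P u.
Proof.
move=> P0 PD PM u; rewrite [u]ext_sum_mon.
by apply: big_rec => // K v _; apply: PD.
Qed.

Fact wedge_is_linear u : linear (wedge u).
Proof.
move=> a v w; apply/ffunP => K; rewrite !ffunE scaler_sumr -big_split /=.
by apply: eq_bigr => I _; rewrite !ffunE /GRing.scale /=; ring.
Qed.

HB.instance Definition _ u :=
  GRing.isLinear.Build R[i] (ext R m) (ext R m) _ (wedge u) (wedge_is_linear u).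

Lemma wedgeDr u v w : wedge u (v + w) = wedge u v + wedge u w.
Proof. exact: raddfD. Qed.

Lemma wedgeZr a u v : wedge u (a *: v) = a *: wedge u v.
Proof. exact: linearZ. Qed.

Lemma wedge0r u : wedge u 0 = 0. Proof. exact: raddf0. Qed.

Fact wedgel_is_linear v : linear ((@wedge R m)^~ v).
Proof.
move=> a u w; apply/ffunP => K; rewrite !ffunE scaler_sumr -big_split /=.
by apply: eq_bigr => I _; rewrite !ffunE /GRing.scale /=; ring.
Qed.

Lemma wedgeDl u v w : wedge (u + v) w = wedge u w + wedge v w.
Proof. by have := wedgel_is_linear w 1 u v; rewrite !scale1r. Qed.

Lemma wedge0l v : wedge 0 v = 0.
Proof. by apply: (addrI (wedge 0 v)); rewrite addr0 -wedgeDl addr0. Qed.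

Lemma wedgeZl a u v : wedge (a *: u) v = a *: wedge u v.
Proof. by have := wedgel_is_linear v a u 0; rewrite !addr0 wedge0l addr0. Qed.

Lemma wedge_sumr T (r : seq T) (P : pred T) (F : T -> ext R m) u :
  wedge u (\sum_(i <- r | P i) F i) = \sum_(i <- r | P i) wedge u (F i).
Proof. exact: raddf_sum. Qed.

Lemma wedge_suml T (r : seq T) (P : pred T) (F : T -> ext R m) v :
  wedge (\sum_(i <- r | P i) F i) v = \sum_(i <- r | P i) wedge (F i) v.
Proof.
by apply: (big_morph (fun x => wedge x v)) => [x y|]; rewrite ?wedgeDl ?wedge0l.
Qed.

Lemma shuffle_invE I J :
  shuffle_inv I J = (\sum_(i in I) \sum_(j in J) (j < i))%N.
Proof.
rewrite /shuffle_inv pair_big_dep /= -sum1_card [RHS]big_mkcond [LHS]big_mkcond /=.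
apply: eq_bigr => -[i j] _; rewrite !inE /=.
by case: (i \in I); case: (j \in J); case: ltnP.
Qed.

Lemma shuffle_invUl I J K : [disjoint I & J] ->
  shuffle_inv (I :|: J) K = (shuffle_inv I K + shuffle_inv J K)%N.
Proof.
move=> dIJ; rewrite !shuffle_invE -bigU //=.
by by apply: eq_bigl => i; rewrite !inE.
Qed.

Lemma shuffle_invUr I J K : [disjoint I & J] ->
  shuffle_inv K (I :|: J) = (shuffle_inv K I + shuffle_inv K J)%N.
Proof.
move=> dIJ; rewrite !shuffle_invE -big_split; apply: eq_bigr => k _ /=.
rewrite -bigU //=; by apply: eq_bigl => i; rewrite !inE.
Qed.

(** Each pair [(i, j)] with [i] in [I] and [j] in [J] is an inversion in exactly one of the two
    orders. This is the source of the sign in [wedge_gradedC]. *)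
Lemma shuffle_invC I J : [disjoint I & J] ->
  (shuffle_inv I J + shuffle_inv J I)%N = (#|I| * #|J|)%N.
Proof.
move=> dIJ; rewrite !shuffle_invE [X in (_ + X)%N]exchange_big -big_split /=.
rewrite -sum1_card big_distrl /=; apply: eq_bigr => i iI.
rewrite mul1n -sum1_card -big_split; apply: eq_bigr => j jJ /=.
have : i != j by apply: contraTneq jJ => <-; rewrite (disjointFr dIJ iI).
by rewrite -val_eqE /=; case: ltngtP.
Qed.

Lemma shuffle_inv0l J : shuffle_inv finset.set0 J = 0%N.
Proof. by rewrite shuffle_invE big_set0. Qed.

Lemma shuffle_inv0r I : shuffle_inv I finset.set0 = 0%N.
Proof. by rewrite shuffle_invE big1 // => i _; rewrite big_set0. Qed.

Lemma wedge_mon I J :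
  wedge (ext_mon I) (ext_mon J) =
  if [disjoint I & J] then (-1) ^+ shuffle_inv I J *: ext_mon (I :|: J) else 0.
Proof.
apply/ffunP => K; rewrite ffunE.
have [IK|IK] := boolP (I \subset K); last first.
  rewrite big1 => [|L LK]; last first.
    by rewrite !ffunE (_ : L == I = false) ?mulr0 ?mul0r //; apply: contraNF IK => /eqP <-.
  case: ifP => _; rewrite !ffunE //.
  have -> : K == I :|: J = false.
    by apply: contraNF IK => /eqP ->; rewrite finset.subsetUl.
  by rewrite scaler0.
rewrite (bigD1 I) //= big1 ?addr0 => [|L /andP[_ LI]]; last first.
  by rewrite !ffunE (negPf LI) mulr0 mul0r.
rewrite !ffunE eqxx mulr1.
have [eJ|nJ] := eqVneq (K :\: I) J.
  rewrite -eJ; have -> : [disjoint I & K :\: I].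
    by rewrite disjoint_sym finset.disjoints_subset; apply/fintype.subsetP => x;
      rewrite !inE => /andP[].
  by rewrite !ffunE finset.setDE finset.setUIr finset.setUCr finset.setIT (finset.setUidPr IK) eqxx.
rewrite mulr0; case: ifP => dIJ; rewrite !ffunE //.
have -> : K == I :|: J = false.
  apply: contraNF nJ => /eqP ->; rewrite finset.setDUl finset.setDv finset.set0U.
  by apply/eqP/finset.setDidPl; rewrite disjoint_sym.
by rewrite scaler0.
Qed.

Opaque ext_mon.

Lemma disjointUl I J K :
  [disjoint I :|: J & K] = [disjoint I & K] && [disjoint J & K].
Proof.
rewrite -!finset.setI_eq0 finset.setIUl.
by rewrite finset.setU_eq0.
Qed.

(** On monomials both sides carry the exponent inv(I, J) + inv(I, K) + inv(J, K), by additivity of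
    [shuffle_inv] in each argument; if two of the index sets meet, both sides vanish. *)
Lemma wedgeA u v w : wedge u (wedge v w) = wedge (wedge u v) w.
Proof.
move: u; apply: ext_ind => [|a u u' IH IH'|I]; first by rewrite !wedge0l.
  by rewrite !(wedgeDl, wedgeZl) IH IH'.
move: v; apply: ext_ind => [|a v v' IH IH'|J].
- by rewrite !wedge0l wedge0r wedge0l.
- by rewrite !(wedgeDl, wedgeDr, wedgeZl, wedgeZr) IH IH'.
move: w; apply: ext_ind => [|a w w' IH IH'|K]; first by rewrite !wedge0r.
  by rewrite !(wedgeDl, wedgeDr, wedgeZl, wedgeZr) IH IH'.
rewrite (wedge_mon I J) (wedge_mon J K).
case: (boolP [disjoint J & K]) => dJK; case: (boolP [disjoint I & J]) => dIJ.
- rewrite wedgeZr wedgeZl !wedge_mon.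
  rewrite disjointUl (disjoint_sym _ (mem (J :|: K))) disjointUl dJK (disjoint_sym J) dIJ.
  rewrite andbT (disjoint_sym (mem K)).
  case: (boolP [disjoint I & K]) => dIK; last by rewrite 2!scaler0.
  rewrite !scalerA -!exprD finset.setUA (shuffle_invUl _ dIJ) (shuffle_invUr _ dJK).
  by congr (_ ^+ _ *: _); rewrite addnC addnA.
- rewrite wedgeZr wedge0l wedge_mon.
  by rewrite disjoint_sym disjointUl disjoint_sym (negPf dIJ) scaler0.
- by rewrite wedgeZl wedge0r wedge_mon disjointUl (negPf dJK) andbF scaler0.
- by rewrite wedge0l wedge0r.
Qed.

Lemma wedge1l u : wedge (ext1 R m) u = u.
Proof.
move: u; apply: ext_ind => [|a u v IH IH'|K]; first by rewrite wedge0r.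
  by rewrite wedgeDr wedgeZr IH IH'.
rewrite (wedge_mon finset.set0) finset.disjoints_subset finset.sub0set.
by rewrite shuffle_inv0l finset.set0U scale1r.
Qed.

Lemma wedge1r u : wedge u (ext1 R m) = u.
Proof.
move: u; apply: ext_ind => [|a u v IH IH'|K]; first by rewrite wedge0l.
  by rewrite wedgeDl wedgeZl IH IH'.
rewrite (wedge_mon K finset.set0) disjoint_sym finset.disjoints_subset finset.sub0set.
by rewrite shuffle_inv0r finset.setU0 scale1r.
Qed.

HB.instance Definition _ :=
  Monoid.isLaw.Build (ext R m) (ext1 R m) (@wedge R m) wedgeA wedge1l wedge1r.

Definition ext_parity (b : bool) u := forall K, u K != 0 -> odd #|K| = b.

Lemma ext_parity0 b : ext_parity b 0.
Proof. by move=> K; rewrite ffunE eqxx. Qed.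

Lemma ext_parityP b a u v :
  ext_parity b u -> ext_parity b v -> ext_parity b (a *: u + v).
Proof.
move=> pu pv K; rewrite !ffunE => uv0.
have [uK|/pu //] := eqVneq (u K) 0.
by apply: pv; move: uv0; rewrite uK scaler0 add0r.
Qed.

Lemma ext_parityZ b x u : ext_parity b u -> ext_parity b (x *: u).
Proof.
move=> pu; rewrite -[_ *: _]addr0; apply: ext_parityP => //; exact: ext_parity0.
Qed.

Lemma ext_parity_sum b T (r : seq T) (P : pred T) (F : T -> ext R m) :
  (forall i, P i -> ext_parity b (F i)) ->
  ext_parity b (\sum_(i <- r | P i) F i).
Proof.
move=> pF; apply: big_rec => [|i u Pi pu]; first exact: ext_parity0.
by rewrite -[F i]scale1r; apply: ext_parityP => //; apply: pF.
Qed.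

Lemma ext_parity_mon K : ext_parity (odd #|K|) (ext_mon K).
Proof. by move=> L; rewrite ext_monE; case: (L =P K) => [->|_] //; rewrite eqxx. Qed.

Lemma ext_parity_ind b (P : ext R m -> Prop) :
  P 0 -> (forall a u v, P u -> P v -> P (a *: u + v)) ->
  (forall K, odd #|K| = b -> P (ext_mon K)) ->
  forall u, ext_parity b u -> P u.
Proof.
move=> P0 PD PM u pu; rewrite [u]ext_sum_mon.
apply: big_rec => // K v _ Pv.
have [->|/pu/PM Pm] := eqVneq (u K) 0; first by rewrite scale0r add0r.
exact: PD.
Qed.

Lemma wedge_gradedC b c u v : ext_parity b u -> ext_parity c v ->
  wedge u v = (-1) ^+ (b && c) *: wedge v u.
Proof.
move: u; apply: ext_parity_ind => [_|a u u' IH IH' pv|I pI].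
- by rewrite wedge0l wedge0r scaler0.
- rewrite wedgeDl wedgeDr wedgeZl wedgeZr (IH pv) (IH' pv) scalerDr.
  by rewrite !scalerA [a * _]mulrC.
move: v; apply: ext_parity_ind => [|a v v' IH IH'|J pJ].
- by rewrite wedge0l wedge0r scaler0.
- rewrite wedgeDl wedgeDr wedgeZl wedgeZr IH IH' scalerDr.
  by rewrite !scalerA [a * _]mulrC.
rewrite !wedge_mon (disjoint_sym (mem J)).
case: (boolP [disjoint I & J]) => dIJ; last by rewrite scaler0.
rewrite scalerA finset.setUC -pI -pJ -oddM -(shuffle_invC dIJ) signr_odd -exprD.
by rewrite -addnA addnn -[in RHS]signr_odd oddD odd_double addbF signr_odd.
Qed.

Lemma ext_parity_wedge b c u v : ext_parity b u -> ext_parity c v ->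
  ext_parity (b (+) c) (wedge u v).
Proof.
move: u; apply: ext_parity_ind => [_|a u u' IH IH' pv|I pI].
- rewrite wedge0l; exact: (ext_parity0 _).
- by rewrite wedgeDl wedgeZl; apply: ext_parityP; [apply: IH|apply: IH'].
move: v; apply: ext_parity_ind => [|a v v' IH IH'|J pJ].
- rewrite wedge0r; exact: (ext_parity0 _).
- by rewrite wedgeDr wedgeZr; apply: ext_parityP.
rewrite wedge_mon; case: ifP => dIJ; last exact: ext_parity0.
rewrite -[_ *: _]addr0; apply: ext_parityP; last exact: ext_parity0.
rewrite -pI -pJ -oddD -(cardsUI I J).
move: dIJ; rewrite -finset.setI_eq0 => /eqP ->; rewrite finset.cards0 addn0.
exact: ext_parity_mon.
Qed.

Lemma ext_parity1 : ext_parity false (ext1 R m).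
Proof. by move=> K; rewrite ffunE; case: (K =P _) => [->|]; rewrite ?finset.cards0 // eqxx. Qed.

Lemma ext_parity_gen k : ext_parity true (ext_gen R k).
Proof. by move=> K; rewrite ffunE; case: (K =P _) => [->|]; rewrite ?finset.cards1 // eqxx. Qed.

Lemma wedge_oddC u v : ext_parity true u -> ext_parity true v ->
  wedge u v = - wedge v u.
Proof. by move=> pu pv; rewrite (wedge_gradedC pu pv) scaleN1r. Qed.

Lemma wedge_odd_sqr u : ext_parity true u -> wedge u u = 0.
Proof.
move=> pu; have /eqP := wedge_oddC pu pu.
by rewrite -subr_eq0 opprK -mulr2n -scaler_nat scaler_eq0 pnatr_eq0 => /eqP.
Qed.

Lemma ext_gen_mon k : ext_gen R k = ext_mon [set k]%SET.
Proof. by apply/ffunP => K; rewrite [RHS]ext_monE ffunE. Qed.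

Lemma ext1_mon : ext1 R m = ext_mon finset.set0.
Proof. by apply/ffunP => K; rewrite [RHS]ext_monE ffunE. Qed.

End ExteriorAlgebra.

(** * Homomorphisms and gradings of exterior algebras *)

Section MinInduction.
Variable m : nat.

(** Adjoining a new least element costs no sign and puts it at the head of [enum], so a monomial
    splits as its first generator times the rest. *)
Lemma set_min_ind (P : {set 'I_m} -> Prop) : P finset.set0 ->
  (forall (j : 'I_m) (J : {set 'I_m}), (forall k, k \in J -> (j < k)%N) -> P J -> P (j |: J)%SET) ->
  forall J, P J.
Proof.
move=> P0 PU J; have [c] := ubnP #|J|; elim: c J => // c IH J ltJ.
have [->//|[i iJ]] := set_0Vmem J.
have jmin : exists2 j, j \in J & forall k, k \in J -> (j <= k)%N.
  by exists [arg min_(k < i in J) val k]; case: arg_minnP.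
have [j jJ leJ] := jmin.
rewrite -(finset.setD1K jJ); apply: PU.
  move=> k; rewrite !inE => /andP[kj /leJ].
  by rewrite leq_eqVlt => /orP[/eqP/val_inj jk|//]; rewrite jk eqxx in kj.
by apply: IH; move: ltJ; rewrite (finset.cardsD1 j) jJ.
Qed.

Lemma sorted_enum_set (A : {set 'I_m}) :
  sorted (fun i j : 'I_m => (i < j)%N) (enum A).
Proof.
rewrite [enum _]/enum_mem; apply: sorted_filter; first by move=> ? ? ?; apply: ltn_trans.
by have := iota_ltn_sorted 0 m; rewrite -val_enum_ord sorted_map enumT.
Qed.

Lemma enum_setU1_min (j : 'I_m) (J : {set 'I_m}) : (forall k, k \in J -> (j < k)%N) ->
  enum (j |: J)%SET = j :: enum J.
Proof.
move=> ltJ; apply: (@irr_sorted_eq _ (fun i j : 'I_m => (i < j)%N)).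
- by move=> ? ? ?; apply: ltn_trans.
- by move=> ?; rewrite ltnn.
- exact: sorted_enum_set.
- have := sorted_enum_set J; case E: (enum J) => [//|k s] /= ->; rewrite andbT.
  by apply: ltJ; rewrite -mem_enum E mem_head.
- by move=> k; rewrite mem_enum in_cons mem_enum !inE.
Qed.

Lemma shuffle_inv_min (j : 'I_m) (J : {set 'I_m}) : (forall k, k \in J -> (j < k)%N) ->
  shuffle_inv [set j]%SET J = 0%N.
Proof.
move=> ltJ; rewrite shuffle_invE big_set1 big1 // => k /ltJ.
by case: ltngtP.
Qed.

End MinInduction.

Section ExteriorHom.
Variables (R : realType) (m m' : nat) (sigma : {rmorphism R[i] -> R[i]}).
Variable x : 'I_m -> ext R m'.
Hypothesis x_odd : forall k, ext_parity true (x k).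

Definition ext_prod (K : {set 'I_m}) : ext R m' :=
  \big[@wedge R m'/ext1 R m']_(k <- enum K) x k.

(** The universal property of the exterior algebra, twisted by a ring endomorphism [sigma] of the
    scalars: [idfun] serves for determinants in [wedge_comb], conjugation for [conj_form]. *)
Definition ext_hom (w : ext R m) : ext R m' :=
  \sum_(K : {set 'I_m}) sigma (w K) *: ext_prod K.

Lemma ext_prod0 : ext_prod finset.set0 = ext1 R m'.
Proof. by rewrite /ext_prod finset.enum_set0 big_nil. Qed.

Lemma ext_prodU1_min (j : 'I_m) (J : {set 'I_m}) : (forall k, k \in J -> (j < k)%N) ->
  ext_prod (j |: J)%SET = wedge (x j) (ext_prod J).
Proof. by move=> ltJ; rewrite /ext_prod enum_setU1_min // big_cons. Qed.

(** The factor [x i] travels to its sorted place past every smaller [x j]; each exchange is one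
    inversion and contributes one sign. *)
Lemma wedge_ext_prod i J : wedge (x i) (ext_prod J) =
  if i \in J then 0 else (-1) ^+ shuffle_inv [set i]%SET J *: ext_prod (i |: J)%SET.
Proof.
move: J; apply: set_min_ind => [|j J ltJ IH].
  rewrite finset.in_set0 shuffle_inv0r scale1r.
  by apply/esym/ext_prodU1_min => k; rewrite finset.in_set0.
rewrite (ext_prodU1_min ltJ) finset.in_setU1.
case: (ltngtP i j) => [ij|ji|/val_inj ->].
- have ltJi k : k \in (j |: J)%SET -> (i < k)%N.
    by rewrite !inE => /orP[/eqP -> //|/ltJ]; apply: ltn_trans.
  have -> : (i == j) = false by apply/eqP => ij'; rewrite ij' ltnn in ij.
  have -> : (i \in J) = false.
    by apply/negP => /ltJ ji; rewrite ltnNge (ltnW ij) in ji.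
  by rewrite (shuffle_inv_min ltJi) scale1r (ext_prodU1_min ltJi) (ext_prodU1_min ltJ).
- rewrite wedgeA (wedge_oddC (@x_odd i) (@x_odd j)) -scaleN1r wedgeZl -wedgeA IH.
  have -> : (i == j) = false by apply/eqP => ij'; rewrite ij' ltnn in ji.
  case: (boolP (i \in J)) => iJ; first by rewrite wedge0r scaler0.
  have ltJ' k : k \in (i |: J)%SET -> (j < k)%N.
    by rewrite !inE => /orP[/eqP ->|/ltJ].
  have dj : [disjoint [set j]%SET & J].
    rewrite finset.disjoints1; apply/negP => /ltJ; by rewrite ltnn.
  rewrite finset.setUCA (ext_prodU1_min ltJ') (shuffle_invUr _ dj) exprD.
  rewrite [shuffle_inv _ [set j]%SET]shuffle_invE !big_set1 ji wedgeZr scalerA.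
  by rewrite expr1.
- by rewrite eqxx wedgeA (wedge_odd_sqr (@x_odd j)) wedge0l.
Qed.

Fact ext_homP a u v : ext_hom (a *: u + v) = sigma a *: ext_hom u + ext_hom v.
Proof.
rewrite /ext_hom scaler_sumr -big_split; apply: eq_bigr => K _ /=.
by rewrite !ffunE rmorphD rmorphM scalerDl scalerA.
Qed.

Lemma ext_hom0 : ext_hom 0 = 0.
Proof. by rewrite /ext_hom big1 // => K _; rewrite ffunE rmorph0 scale0r. Qed.

Lemma ext_homZ a u : ext_hom (a *: u) = sigma a *: ext_hom u.
Proof. by rewrite -[a *: u]addr0 ext_homP ext_hom0 addr0. Qed.

Lemma ext_homD u v : ext_hom (u + v) = ext_hom u + ext_hom v.
Proof. by rewrite -[u]scale1r ext_homP rmorph1 !scale1r. Qed.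

Lemma ext_hom_sum T (r : seq T) (P : pred T) (F : T -> ext R m) :
  ext_hom (\sum_(i <- r | P i) F i) = \sum_(i <- r | P i) ext_hom (F i).
Proof. by apply: (big_morph ext_hom); [exact: ext_homD|exact: ext_hom0]. Qed.

Lemma ext_hom_mon K : ext_hom (ext_mon R K) = ext_prod K.
Proof.
rewrite /ext_hom (bigD1 K) //= big1 => [|L LK].
  by rewrite ext_monE eqxx rmorph1 scale1r addr0.
by rewrite ext_monE (negPf LK) rmorph0 scale0r.
Qed.

Lemma ext_hom1 : ext_hom (ext1 R m) = ext1 R m'.
Proof. by rewrite ext1_mon ext_hom_mon ext_prod0. Qed.

Lemma ext_hom_gen k : ext_hom (ext_gen R k) = x k.
Proof.
rewrite ext_gen_mon ext_hom_mon -(finset.setU0 [set k]%SET) ext_prodU1_min.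
  by rewrite ext_prod0 wedge1r.
by move=> l; rewrite finset.in_set0.
Qed.

(** The left factor is reduced to a monomial and consumed from its least generator on; the case
    [gen] of a single generator is [wedge_ext_prod]. *)
Lemma ext_hom_wedge u v : ext_hom (wedge u v) = wedge (ext_hom u) (ext_hom v).
Proof.
have gen k w : ext_hom (wedge (ext_gen R k) w) = wedge (x k) (ext_hom w).
  move: w; apply: ext_ind => [|a w w' IH IH'|J].
  - by rewrite wedge0r ext_hom0 wedge0r.
  - by rewrite wedgeDr wedgeZr 2!ext_homP wedgeDr wedgeZr IH IH'.
  rewrite ext_gen_mon wedge_mon ext_hom_mon wedge_ext_prod finset.disjoints1.
  case: (boolP (k \in J)) => _ /=; first by rewrite ext_hom0.
  by rewrite ext_homZ rmorph_sign ext_hom_mon.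
move: u; apply: ext_ind => [|a u u' IH IH'|].
- by rewrite wedge0l ext_hom0 wedge0l.
- by rewrite wedgeDl wedgeZl 2!ext_homP wedgeDl wedgeZl IH IH'.
apply: set_min_ind => [|j J ltJ IH].
  by rewrite -ext1_mon wedge1l ext_hom1 wedge1l.
have -> : ext_mon R (j |: J)%SET = wedge (ext_gen R j) (ext_mon R J).
  rewrite ext_gen_mon wedge_mon finset.disjoints1.
  have -> : (j \in J) = false by apply/negP => /ltJ; rewrite ltnn.
  by rewrite (shuffle_inv_min ltJ) scale1r.
by rewrite -wedgeA gen IH gen wedgeA.
Qed.

Lemma ext_hom_prod T (r : seq T) (P : pred T) (F : T -> ext R m) :
  ext_hom (\big[@wedge R m/ext1 R m]_(i <- r | P i) F i) =
  \big[@wedge R m'/ext1 R m']_(i <- r | P i) ext_hom (F i).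
Proof. by apply: (big_morph ext_hom); [exact: ext_hom_wedge|exact: ext_hom1]. Qed.

Lemma ext_parity_hom b u : ext_parity b u -> ext_parity b (ext_hom u).
Proof.
move=> pu; apply: ext_parity_sum => K _.
have [->|/pu <-] := eqVneq (u K) 0; first by rewrite rmorph0 scale0r; exact: ext_parity0.
apply: ext_parityZ; move: K; apply: set_min_ind => [|j J ltJ IH].
  by rewrite ext_prod0 finset.cards0; exact: ext_parity1.
rewrite (ext_prodU1_min ltJ) finset.cardsU1.
have -> : j \notin J by apply/negP => /ltJ; rewrite ltnn.
exact: (@ext_parity_wedge _ _ true).
Qed.

End ExteriorHom.

Section Grading.
Variables (R : realType) (m : nat) (deg : {set 'I_m} -> nat).
Hypothesis degD : forall I K : {set 'I_m},
  I \subset K -> (deg I + deg (K :\: I)%SET)%N = deg K.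
Implicit Types u v : ext R m.

(** The statistic [deg] stays abstract because three are needed: the cardinality in [wedge_comb],
    and the numbers of [dz] and of [dzbar] factors for bidegrees. *)
Definition ext_graded d u := forall K, u K != 0 -> deg K = d.

Lemma ext_graded_wedge d e u v :
  ext_graded d u -> ext_graded e v -> ext_graded (d + e) (wedge u v).
Proof.
move=> gu gv K; rewrite ffunE => /eqP K0.
have [I /andP[IK uv0]] : exists I : {set 'I_m}, (I \subset K) && (u I * v (K :\: I)%SET != 0).
  apply/existsP; apply: contra_notT K0 => /existsPn K0.
  apply: big1 => I IK; move: (K0 I); rewrite IK /= negbK => /eqP uv0.
  by rewrite -mulrA uv0 mulr0.
have uI : u I != 0 by apply: contraNneq uv0 => ->; rewrite mul0r.
have vI : v (K :\: I)%SET != 0 by apply: contraNneq uv0 => ->; rewrite mulr0.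
by rewrite -(gu _ uI) -(gv _ vI) degD.
Qed.

Lemma ext_graded0 d : ext_graded d (0 : ext R m).
Proof. by move=> K; rewrite ffunE eqxx. Qed.

Lemma ext_gradedD d u v : ext_graded d u -> ext_graded d v -> ext_graded d (u + v).
Proof.
move=> gu gv K; rewrite ffunE => uv0.
have [uK|/gu //] := eqVneq (u K) 0.
by apply: gv; move: uv0; rewrite uK add0r.
Qed.

Lemma ext_gradedZ d a u : ext_graded d u -> ext_graded d (a *: u).
Proof.
move=> gu K; rewrite ffunE => uv0; apply: gu.
by apply: contraNneq uv0 => ->; rewrite scaler0.
Qed.

Lemma ext_graded_sum d T (r : seq T) (P : pred T) (F : T -> ext R m) :
  (forall i, P i -> ext_graded d (F i)) ->
  ext_graded d (\sum_(i <- r | P i) F i).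
Proof.
move=> gF; apply: (big_ind (ext_graded d)) => //; first exact: ext_graded0.
by move=> u v; apply: ext_gradedD.
Qed.

Lemma ext_graded_prod q d (F : 'I_q -> ext R m) :
  (forall i, ext_graded d (F i)) ->
  ext_graded (q * d) (\big[@wedge R m/ext1 R m]_(i < q) F i).
Proof.
elim: q F => [|q IH] F gF.
  rewrite big_ord0 mul0n => K; rewrite ffunE.
  case: (K =P finset.set0) => [-> _|_]; last by rewrite eqxx.
  by apply: (@addnI (deg finset.set0)); have := degD (subxx finset.set0);
    rewrite finset.setD0 addn0.
rewrite big_ord_recr mulSnr; apply: ext_graded_wedge => //.
by apply: IH.
Qed.

End Grading.

(** * Products of odd forms and of linear combinations of them *)

Section Products.
Variable R : realType.

Lemma ext_parity_prod m q (x : 'I_q -> ext R m) :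
  (forall s, ext_parity true (x s)) ->
  ext_parity (odd q) (\big[@wedge R m/ext1 R m]_(s < q) x s).
Proof.
elim: q x => [|q IH] x px; first by rewrite big_ord0; apply: ext_parity1.
rewrite big_ord_recr /=; have -> : ~~ odd q = odd q (+) true by rewrite addbT.
by apply: ext_parity_wedge => //; apply: IH.
Qed.

Lemma cards_setD m (I K : {set 'I_m}) :
  I \subset K -> (#|I| + #|(K :\: I)%SET|)%N = #|K|.
Proof. by move=> IK; rewrite -(finset.cardsID I K) (finset.setIidPr IK). Qed.

(* The scalar [d] is [\det L]. *)
Lemma wedge_comb q (L : 'M[R[i]]_q) : exists d : R[i],
  forall m (x : 'I_q -> ext R m), (forall t, ext_parity true (x t)) ->
  \big[@wedge R m/ext1 R m]_(s < q) (\sum_(t < q) L s t *: x t) =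
  d *: \big[@wedge R m/ext1 R m]_(t < q) x t.
Proof.
pose w : ext R q :=
  \big[@wedge R q/ext1 R q]_(s < q) (\sum_(t < q) L s t *: ext_gen R t).
exists (w [set: 'I_q]%SET) => m x px.
have -> : \big[@wedge R m/ext1 R m]_(s < q) (\sum_(t < q) L s t *: x t) =
    ext_hom idfun x w.
  rewrite ext_hom_prod //; apply: eq_bigr => s _; rewrite ext_hom_sum.
  by apply: eq_bigr => t _; rewrite ext_homZ ext_hom_gen.
(* With only [q] generators, a form of degree [q] is a multiple of the top monomial. Computing once
   on generators and transporting by [ext_hom] makes the scalar independent of [m] and [x]. *)
have gw : ext_graded (fun K => #|K|) (q * 1) w.
  apply: ext_graded_prod => [|s]; first exact: cards_setD.
  apply: ext_graded_sum => t _; apply: ext_gradedZ => K; rewrite ffunE.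
  by case: (K =P _) => [->|]; rewrite ?finset.cards1 // eqxx.
rewrite /ext_hom (bigD1 [set: 'I_q]%SET) //= big1 ?addr0 => [|K KT].
  congr (_ *: _); rewrite /ext_prod.
  by rewrite -deprecated_filter_index_enum big_filter; apply: eq_bigl => i; exact: finset.in_setT.
have [->|/gw] := eqVneq (w K) 0; first by rewrite scale0r.
rewrite muln1 => /eqP cK; case/eqP: KT; apply/eqP.
by rewrite finset.eqEcard finset.subsetT finset.cardsT card_ord (eqP cK) /=.
Qed.

(** Moving the new [x] past [q] factors [y] costs (-1)^q = i^(2q), and the new pair brings one more
    ['i]; since q^2 + 2q + 1 = (q + 1)^2, this accounts for the exponent in the definition of
    positivity. *)
Lemma wedge_prod_pairs m q (x y : 'I_q -> ext R m) :
  (forall s, ext_parity true (x s)) -> (forall s, ext_parity true (y s)) ->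
  \big[@wedge R m/ext1 R m]_(s < q) ('i *: wedge (x s) (y s)) =
  'i ^+ (q ^ 2)%N *: wedge (\big[@wedge R m/ext1 R m]_(s < q) x s)
                        (\big[@wedge R m/ext1 R m]_(s < q) y s).
Proof.
elim: q x y => [|q IH] x y px py.
  by rewrite !big_ord0 wedge1l scale1r.
rewrite !big_ord_recr /= IH //.
set X := bigop _ _ _; set Y := bigop _ _ _.
have pY : ext_parity (odd q) Y by apply: ext_parity_prod.
rewrite wedgeZr wedgeZl -!wedgeA [wedge Y _]wedgeA (wedge_gradedC pY (px _)).
rewrite andbT wedgeZl wedgeZr !wedgeA !scalerA; congr (_ *: _).
rewrite signr_odd -sqrCi -exprM -exprS -exprD; congr (_ ^+ _).
by rewrite -!mulnn mulSn mulnS; lia.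
Qed.

End Products.

(** * The commutative ring of even forms *)

Section EvenForms.
Variables (R : realType) (m : nat).

Definition is_even : {pred ext R m} :=
  fun w => [forall K : {set 'I_m}, (w K != 0) ==> ~~ odd #|K|].

Lemma is_evenP w : reflect (ext_parity false w) (w \in is_even).
Proof.
apply: (iffP forallP) => [ew K /(implyP (ew K)) /negPf //|pw K].
by apply/implyP => /pw ->.
Qed.

Fact is_even_zmod : zmod_closed is_even.
Proof.
split=> [|u v /is_evenP pu /is_evenP pv]; apply/is_evenP; first exact: ext_parity0.
by rewrite addrC -scaleN1r; apply: ext_parityP.
Qed.

HB.instance Definition _ := GRing.isZmodClosed.Build (ext R m) is_even is_even_zmod.

(** Curvature entries have degree 2, hence lie in this subring; it is commutative, which gives
    access to [ring], to determinants and to matrix products of forms. *)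
Record even_ext := EvenExt { even_val : ext R m; _ : even_val \in is_even }.

HB.instance Definition _ := [isSub for even_val].
HB.instance Definition _ := [Choice of even_ext by <:].
HB.instance Definition _ := [SubChoice_isSubZmodule of even_ext by <:].

Implicit Types a b c : even_ext.

Lemma even_valP a : ext_parity false (even_val a).
Proof. exact/is_evenP/(valP a). Qed.

Fact even_one_subproof : ext1 R m \in is_even.
Proof. exact/is_evenP/ext_parity1. Qed.

Fact even_mul_subproof a b : wedge (even_val a) (even_val b) \in is_even.
Proof. by apply/is_evenP/(@ext_parity_wedge _ _ false false); exact: even_valP. Qed.

Definition even_one := EvenExt even_one_subproof.
Definition even_mul a b := EvenExt (even_mul_subproof a b).

Fact even_mulA : associative even_mul.
Proof. by move=> a b c; apply/val_inj; exact: wedgeA. Qed.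

Fact even_mulC : commutative even_mul.
Proof.
move=> a b; apply/val_inj => /=.
by rewrite (wedge_gradedC (@even_valP a) (@even_valP b)) scale1r.
Qed.

Fact even_mul1 : left_id even_one even_mul.
Proof. by move=> a; apply/val_inj; exact: wedge1l. Qed.

Fact even_mulDl : left_distributive even_mul +%R.
Proof. by move=> a b c; apply/val_inj; exact: wedgeDl. Qed.

Fact even_one_neq0 : even_one != 0.
Proof.
apply/eqP => /(congr1 even_val)/ffunP/(_ finset.set0).
by rewrite !ffunE eqxx => /eqP; rewrite oner_eq0.
Qed.

HB.instance Definition _ := GRing.Zmodule_isComNzRing.Build even_ext
  even_mulA even_mulC even_mul1 even_mulDl even_one_neq0.

Lemma even_valM a b : even_val (a * b) = wedge (even_val a) (even_val b).
Proof. by []. Qed.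

Lemma even_val1 : even_val 1 = ext1 R m. Proof. by []. Qed.

Lemma even_val0 : even_val 0 = 0. Proof. by []. Qed.

Lemma even_valD a b : even_val (a + b) = even_val a + even_val b.
Proof. by []. Qed.

Lemma even_valN a : even_val (- a) = - even_val a.
Proof. by []. Qed.

Lemma even_val_sum T (r : seq T) (P : pred T) (F : T -> even_ext) :
  even_val (\sum_(i <- r | P i) F i) = \sum_(i <- r | P i) even_val (F i).
Proof. by apply: (big_morph even_val); [exact: even_valD|exact: even_val0]. Qed.

Lemma even_val_prod T (r : seq T) (P : pred T) (F : T -> even_ext) :
  even_val (\prod_(i <- r | P i) F i) =
  \big[@wedge R m/ext1 R m]_(i <- r | P i) even_val (F i).
Proof. by apply: (big_morph even_val); [exact: even_valM|exact: even_val1]. Qed.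

(* This and some later definitions are locked: when an equation between two forms fails to
   hold, unification would otherwise unfold both down to their coefficients. *)
Definition to_even (w : ext R m) : even_ext := locked (insubd 0) w.

Lemma to_evenK w : ext_parity false w -> even_val (to_even w) = w.
Proof. by move=> pw; rewrite /to_even -lock; apply: insubdK; apply/is_evenP. Qed.

Definition even_scal (x : R[i]) : even_ext :=
  locked (fun x : R[i] => to_even (x *: ext1 R m)) x.

Lemma even_val_scal x : even_val (even_scal x) = x *: ext1 R m.
Proof.
rewrite /even_scal -lock; apply: to_evenK; apply: ext_parityZ; exact: ext_parity1.
Qed.

Lemma even_val_scalM x a : even_val (even_scal x * a) = x *: even_val a.
Proof. by rewrite even_valM even_val_scal wedgeZl wedge1l. Qed.

Fact even_scal_zmod : zmod_morphism even_scal.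
Proof.
move=> x y; apply/val_inj; rewrite [RHS]even_valD even_valN.
by rewrite [LHS]even_val_scal (even_val_scal x) (even_val_scal y) scalerBl.
Qed.

Fact even_scal_monoid : monoid_morphism even_scal.
Proof.
split; first by apply/val_inj; rewrite [LHS]even_val_scal scale1r.
by move=> x y; apply/val_inj; rewrite [RHS]even_val_scalM [LHS]even_val_scal even_val_scal scalerA.
Qed.

HB.instance Definition _ :=
  GRing.isZmodMorphism.Build R[i] even_ext even_scal even_scal_zmod.
HB.instance Definition _ :=
  GRing.isMonoidMorphism.Build R[i] even_ext even_scal even_scal_monoid.

Lemma even_scal_inj x a b : x != 0 -> even_scal x * a = even_scal x * b -> a = b.
Proof.
move=> x0 /(congr1 even_val); rewrite !even_val_scalM => eab.
by apply/val_inj/(scalerI x0).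
Qed.

End EvenForms.

(** * Identities in commutative rings *)

Section CommutativeIdentities.
Variable S : comNzRingType.

Lemma sum3E (V : nmodType) (F : 'I_3 -> V) :
  \sum_(i < 3) F i = F 0 + F 1 + F 2.
Proof.
rewrite !big_ord_recr big_ord0 /= add0r.
by congr (F _ + F _ + F _); apply/val_inj.
Qed.

Definition sesq (A : 'M[S]_3) (u v : 'I_3 -> S) : S :=
  \sum_(b < 3) \sum_(c < 3) u b * A b c * v c.

(* [c1 c2 - c3] of [A], the Schur polynomial of the partition (2, 1). *)
Definition schur21 (A : 'M[S]_3) : S :=
  (A 0 0 + A 1 1 + A 2 2) *
  (A 0 0 * A 1 1 - A 0 1 * A 1 0 + (A 0 0 * A 2 2 - A 0 2 * A 2 0)
   + (A 1 1 * A 2 2 - A 1 2 * A 2 1))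
  - (A 0 0 * (A 1 1 * A 2 2 - A 1 2 * A 2 1)
     - A 0 1 * (A 1 0 * A 2 2 - A 1 2 * A 2 0)
     + A 0 2 * (A 1 0 * A 2 1 - A 1 1 * A 2 0)).

Lemma schur21_tr (A : 'M[S]_3) : schur21 A^T = schur21 A.
Proof. by rewrite /schur21 !mxE; ring. Qed.

Lemma schur21_map (f : {rmorphism S -> S}) (A : 'M[S]_3) :
  schur21 (map_mx f A) = f (schur21 A).
Proof. by rewrite /schur21 !mxE !(rmorphD, rmorphN, rmorphM). Qed.

(* [u'] and [v'] stand for the complex conjugates of [u] and [v]. *)
Definition plane_form (A : 'M[S]_3) (u' u v' v : 'I_3 -> S) : S :=
  sesq A u' u * (sesq A u' u * sesq A v' v - sesq A u' v * sesq A v' u).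

Definition vec3 (x y z : S) : 'I_3 -> S := fun i => [:: x; y; z]`_i.

Lemma vec3E x y z : (vec3 x y z 0 = x) * (vec3 x y z 1 = y) * (vec3 x y z 2 = z).
Proof. by []. Qed.

Section CubeRootOfUnity.
Variable w : S.
Hypothesis Hw : w * w = - 1 - w.

(* The matrix is [[a, x, z], [x', b, y], [z', y', c]]; [s], [vv], [uv], ... are its entries
   in the Fourier basis (1, 1, 1), (1, w, w'), (1, w', w). *)
Lemma fourier_minors (a b c x x' y y' z z' : S) :
  let w' := - 1 - w in
  let s := a + b + c + x + x' + y + y' + z + z' in
  let vv := a + b + c + x * w + x' * w' + y * w + y' * w' + z * w' + z' * w in
  let uv := a + x' + z' + (x + b + y') * w + (z + y + c) * w' in
  let vu := a + x + z + (x' + b + y) * w' + (z' + y' + c) * w in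
  let vv1 := a + b + c + x * w' + x' * w + y * w' + y' * w + z * w + z' * w' in
  let uv1 := a + x' + z' + (x + b + y') * w' + (z + y + c) * w in
  let vu1 := a + x + z + (x' + b + y) * w + (z' + y' + c) * w' in
  (s * vv - uv * vu) + (s * vv1 - uv1 * vu1) =
  3 * (3 * (a * b - x * x' + (b * c - y * y') + (a * c - z * z'))
   - ((b * c - y * y') + (a * c - z * z') + (a * b - x * x')
     - (x * c - z * y') - (x' * c - y * z')
     + (x * y - b * z) + (x' * y' - b * z')
     - (a * y - x' * z) - (a * y' - x * z'))).
Proof. cbv zeta beta. ring: Hw.
Qed.

(** [F] is a product of two Laurent polynomials in [t] and [s], with [t'] and [s'] the inverses.
    Their seven exponents, zero and the six roots of A2, are distinct modulo 3 and stable under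
    negation, so summing over cube roots of unity keeps only products of opposite coefficients. *)
Lemma fourier_product_sum (p0 p1 p2 p3 p4 p5 p6 q0 q1 q2 q3 q4 q5 q6 : S) :
  let w' := - 1 - w in
  let F (t t' s s' : S) :=
   (p0 + t * p1 + t' * p2 + s * p3 + s' * p4 + t' * s * p5 + t * s' * p6) *
   (q0 + t * q1 + t' * q2 + s * q3 + s' * q4 + t' * s * q5 + t * s' * q6) in
  F 1 1 1 1 + F 1 1 w w' + F 1 1 w' w
  + (F w w' 1 1 + F w w' w w' + F w w' w' w)
  + (F w' w 1 1 + F w' w w w' + F w' w w' w) =
  9 * (p0 * q0 + p1 * q2 + p2 * q1 + p3 * q4 + p4 * q3 + p5 * q6 + p6 * q5).
Proof. cbv zeta beta. ring: Hw.
Qed.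

(** The vectors (1, t w, r w') and (1, t w', r w) are the two Fourier vectors orthogonal to (1, t,
    r), since 1 + w + w' = 0. Conjugating [A] by diag(1, t, r) reduces to t = r = 1, which is
    [fourier_minors]; the common factor is [<A u, u>]. *)
Lemma plane_form_fourier (A : 'M[S]_3) (t t' r r' : S) : t * t' = 1 -> r * r' = 1 ->
  let w' := - 1 - w in
  plane_form A (vec3 1 t' r') (vec3 1 t r) (vec3 1 (t' * w') (r' * w)) (vec3 1 (t * w) (r * w')) +
  plane_form A (vec3 1 t' r') (vec3 1 t r) (vec3 1 (t' * w) (r' * w')) (vec3 1 (t * w') (r * w)) =
  3 * ((A 0 0 + A 1 1 + A 2 2 + t * A 0 1 + t' * A 1 0 + r * A 0 2 + r' * A 2 0
        + t' * r * A 1 2 + t * r' * A 2 1) *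
  (2 * (A 0 0 * A 1 1 - A 0 1 * A 1 0 + (A 0 0 * A 2 2 - A 0 2 * A 2 0)
        + (A 1 1 * A 2 2 - A 1 2 * A 2 1))
   + t * (A 0 1 * A 2 2 - A 0 2 * A 2 1) + t' * (A 1 0 * A 2 2 - A 1 2 * A 2 0)
   + r * (A 1 1 * A 0 2 - A 0 1 * A 1 2) + r' * (A 1 1 * A 2 0 - A 1 0 * A 2 1)
   + t' * r * (A 0 0 * A 1 2 - A 1 0 * A 0 2) + t * r' * (A 0 0 * A 2 1 - A 0 1 * A 2 0))).
Proof.
move=> Ht Hr w'.
have := fourier_minors (A 0 0) (A 1 1) (A 2 2) (t * A 0 1) (t' * A 1 0)
  (t' * r * A 1 2) (t * r' * A 2 1)
  (r * A 0 2) (r' * A 2 0).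
cbv zeta.
set s := (X in X * _ - _ + _ = _); set vv := (X in s * X - _ + _ = _).
set uv := (X in _ - X * _ + _ = _); set vu := (X in _ - uv * X + _ = _).
set vv1 := (X in _ + (s * X - _) = _); set uv1 := (X in _ + (_ - X * _) = _).
set vu1 := (X in _ + (_ - uv1 * X) = _) => F.
transitivity (s * (s * vv - uv * vu + (s * vv1 - uv1 * vu1))); last first.
  rewrite {}F /s {s vv uv vu vv1 uv1 vu1}; ring: Ht Hr.
rewrite /plane_form.
have -> : sesq A (vec3 1 t' r') (vec3 1 t r) = s.
  by rewrite /sesq !sum3E !vec3E /s; ring: Ht Hr.
have -> : sesq A (vec3 1 (t' * w') (r' * w)) (vec3 1 (t * w) (r * w')) = vv.
  by rewrite /sesq !sum3E !vec3E /vv /w'; ring: Ht Hr Hw.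
have -> : sesq A (vec3 1 (t' * w) (r' * w')) (vec3 1 (t * w') (r * w)) = vv1.
  by rewrite /sesq !sum3E !vec3E /vv1 /w'; ring: Ht Hr Hw.
have -> : sesq A (vec3 1 t' r') (vec3 1 (t * w) (r * w')) = uv.
  by rewrite /sesq !sum3E !vec3E /uv /w'; ring: Ht Hr.
have -> : sesq A (vec3 1 t' r') (vec3 1 (t * w') (r * w)) = uv1.
  by rewrite /sesq !sum3E !vec3E /uv1 /w'; ring: Ht Hr.
have -> : sesq A (vec3 1 (t' * w') (r' * w)) (vec3 1 t r) = vu.
  by rewrite /sesq !sum3E !vec3E /vu /w'; ring: Ht Hr.
have -> : sesq A (vec3 1 (t' * w) (r' * w')) (vec3 1 t r) = vu1.
  by rewrite /sesq !sum3E !vec3E /vu1 /w'; ring: Ht Hr.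
by rewrite -mulrDr.
Qed.

(* Averaging [<A u, u> <Lambda^2 A (u /\ v), u /\ v>] over all orthonormal
   [u], [v] gives [(c1 c2 - c3) / 8]; the sum below is a finite substitute, over pairs of
   orthogonal vectors of the standard basis and of its Fourier transforms. *)
Lemma schur21_plane_forms (A : 'M[S]_3) :
  let w' := - 1 - w in
  let roots := [:: (1, 1); (w, w'); (w', w)] in
  let e i := fun j : 'I_3 => (j == i)%:R in
  81 * schur21 A =
  \sum_(t <- roots) \sum_(r <- roots)
    (plane_form A (vec3 1 t.2 r.2) (vec3 1 t.1 r.1)
       (vec3 1 (t.2 * w') (r.2 * w)) (vec3 1 (t.1 * w) (r.1 * w')) +
     plane_form A (vec3 1 t.2 r.2) (vec3 1 t.1 r.1)
       (vec3 1 (t.2 * w) (r.2 * w')) (vec3 1 (t.1 * w') (r.1 * w))) +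
  27 * \sum_(i < 3) \sum_(k < 3 | k != i) plane_form A (e i) (e i) (e k) (e k).
Proof.
have Hw' : w * (- 1 - w) = 1 by ring: Hw.
have Hw'' : (- 1 - w) * w = 1 by ring: Hw.
move=> w' roots e.
have plane_e i k : i != k ->
    plane_form A (e i) (e i) (e k) (e k) = A i i * (A i i * A k k - A i k * A k i).
  have sesq_e a b : sesq A (e a) (e b) = A a b.
    rewrite /sesq (bigD1 a) //= (bigD1 b) //= /e !eqxx mul1r mulr1.
    rewrite big1 ?addr0 => [|j /negPf jb]; last by rewrite jb mulr0.
    rewrite big1 ?addr0 // => j /negPf ja.
    by rewrite big1 // => l _; rewrite ja !mul0r.
  by move=> _; rewrite /plane_form !sesq_e.
have -> : \sum_(i < 3) \sum_(k < 3 | k != i) plane_form A (e i) (e i) (e k) (e k) =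
   \sum_(i < 3) \sum_(k < 3 | k != i) A i i * (A i i * A k k - A i k * A k i).
  by apply: eq_bigr => i _; apply: eq_bigr => k ki; rewrite plane_e // eq_sym.
have sum_offdiag (F : 'I_3 -> 'I_3 -> S) : \sum_(i < 3) \sum_(k < 3 | k != i) F i k =
    F 0 1 + F 0 2 + (F 1 0 + F 1 2) + (F 2 0 + F 2 1).
  by rewrite sum3E; congr (_ + _ + _); rewrite big_mkcond sum3E /= ?add0r ?addr0.
rewrite sum_offdiag.
rewrite /roots !big_cons !big_nil !addr0 /=.
rewrite !plane_form_fourier ?mulr1 //.
have := fourier_product_sum (A 0 0 + A 1 1 + A 2 2) (A 0 1) (A 1 0) (A 0 2) (A 2 0) (A 1 2) (A 2 1)
  (2 * (A 0 0 * A 1 1 - A 0 1 * A 1 0 + (A 0 0 * A 2 2 - A 0 2 * A 2 0)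
        + (A 1 1 * A 2 2 - A 1 2 * A 2 1)))
  (A 0 1 * A 2 2 - A 0 2 * A 2 1) (A 1 0 * A 2 2 - A 1 2 * A 2 0)
  (A 1 1 * A 0 2 - A 0 1 * A 1 2) (A 1 1 * A 2 0 - A 1 0 * A 2 1)
  (A 0 0 * A 1 2 - A 1 0 * A 0 2) (A 0 0 * A 2 1 - A 0 1 * A 2 0).
cbv zeta beta; rewrite -/w'.
(* The Fourier terms add up to 27 (2 c1 c2 + X), where X pairs off-diagonal entries with minors. The
   standard basis terms, with the same weight 27, complete X to c1 c2 - 3 c3; the total is 81 (c1 c2
   - c3). *)
set D := 9 * _ => ED.
transitivity (3 * D + 27 * (A 0 0 * (A 0 0 * A 1 1 - A 0 1 * A 1 0)
 + A 0 0 * (A 0 0 * A 2 2 - A 0 2 * A 2 0)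
 + (A 1 1 * (A 1 1 * A 0 0 - A 1 0 * A 0 1) + A 1 1 * (A 1 1 * A 2 2 - A 1 2 * A 2 1))
 + (A 2 2 * (A 2 2 * A 0 0 - A 2 0 * A 0 2) + A 2 2 * (A 2 2 * A 1 1 - A 2 1 * A 1 2)))).
  by rewrite /D /schur21; ring.
by rewrite -ED; ring.
Qed.

End CubeRootOfUnity.

(* [pjk] stands for [i x_j /\ y_k]. *)
Lemma pair_det (x00 x01 x02 x10 x11 x12 x20 x21 x22 p00 p01 p02 p10 p11 p12 p20 p21 p22 : S) :
   let r0 := x00 * p00 + x01 * p01 + x02 * p02 in
   let r1 := x10 * p10 + x11 * p11 + x12 * p12 in
   let r2 := x20 * p20 + x21 * p21 + x22 * p22 in
   p00 * p10 = 0 -> p01 * p11 = 0 -> p02 * p12 = 0 ->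
   p10 * p20 = 0 -> p11 * p21 = 0 -> p12 * p22 = 0 ->
   p00 * p20 = 0 -> p01 * p21 = 0 -> p02 * p22 = 0 ->
   p01 * p10 = - (p00 * p11) -> p02 * p10 = - (p00 * p12) -> p02 * p11 = - (p01 * p12) ->
   p11 * p20 = - (p10 * p21) -> p12 * p20 = - (p10 * p22) -> p12 * p21 = - (p11 * p22) ->
   p01 * p20 = - (p00 * p21) -> p02 * p20 = - (p00 * p22) -> p02 * p21 = - (p01 * p22) ->
   r0 * r1 * r2 = (x00 * (x11 * x22 - x12 * x21) - x01 * (x10 * x22 - x12 * x20)
    + x02 * (x10 * x21 - x11 * x20)) * (p00 * p11 * p22).
Proof.
move=> r0 r1 r2 H1 H2 H3 H4 H5 H6 H7 H8 H9 H11 H12 H13 H14 H15 H16 H17 H18 H19.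
(* Laplace expansion on the first two rows: a repeated column gives zero and exchanged columns give
   opposite products, which leaves three 2x2 minors. *)
have -> : r0 * r1 = (x00 * x11 - x01 * x10) * (p00 * p11) + (x00 * x12 - x02 * x10) * (p00 * p12)
  + (x01 * x12 - x02 * x11) * (p01 * p12).
  transitivity ((x00 * x11 - x01 * x10) * (p00 * p11) + (x00 * x12 - x02 * x10) * (p00 * p12)
  + (x01 * x12 - x02 * x11) * (p01 * p12)
  + x00 * x10 * (p00 * p10) + x01 * x11 * (p01 * p11) + x02 * x12 * (p02 * p12)
  + x01 * x10 * (p01 * p10 + p00 * p11) + x02 * x10 * (p02 * p10 + p00 * p12)
  + x02 * x11 * (p02 * p11 + p01 * p12)).
    by rewrite /r0 /r1; ring.
  by rewrite H1 H2 H3 H11 H12 H13 !addNr !mulr0 !addr0.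
have E1 : p00 * p11 * p20 = 0 by ring: H1 H14.
have E2 : p00 * p11 * p21 = 0 by ring: H5.
have E3 : p00 * p12 * p20 = 0 by ring: H1 H15.
have E4 : p00 * p12 * p22 = 0 by ring: H6.
have E5 : p01 * p12 * p21 = 0 by ring: H2 H16.
have E6 : p01 * p12 * p22 = 0 by ring: H6.
have E7 : p00 * p12 * p21 = - (p00 * p11 * p22) by ring: H16.
have E8 : p01 * p12 * p20 = p00 * p11 * p22 by ring: H15 H11.
transitivity ((x00 * (x11 * x22 - x12 * x21) - x01 * (x10 * x22 - x12 * x20)
    + x02 * (x10 * x21 - x11 * x20)) * (p00 * p11 * p22)
  + (x00 * x11 - x01 * x10) * (x20 * (p00 * p11 * p20) + x21 * (p00 * p11 * p21))
  + (x00 * x12 - x02 * x10) * (x20 * (p00 * p12 * p20) + x21 * (p00 * p12 * p21 + p00 * p11 * p22)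
    + x22 * (p00 * p12 * p22))
  + (x01 * x12 - x02 * x11) * (x20 * (p01 * p12 * p20 - p00 * p11 * p22)
    + x21 * (p01 * p12 * p21) + x22 * (p01 * p12 * p22))).
  by rewrite /r2; ring.
by rewrite E1 E2 E3 E4 E5 E6 E7 E8 addNr subrr !mulr0 !addr0 !mulr0 !addr0.
Qed.

(** Congruence modulo the annihilator of [p] is compatible with products. Here [p] will be the test
    form, modulo which each (1,1)-form reduces to a 3x3 block. *)
Lemma plane_form_mod (a b k l a' b' k' l' p : S) :
  a * p = a' * p -> b * p = b' * p -> k * p = k' * p -> l * p = l' * p ->
  a * (a * b - k * l) * p = (a' * a' * b' - a' * k' * l') * p.
Proof.
move=> Ha Hb Hk Hl.
have mul3_mod x y z x' y' z' : x * p = x' * p -> y * p = y' * p -> z * p = z' * p ->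
    x * y * z * p = x' * y' * z' * p.
  move=> Hx Hy Hz.
  have -> : x * y * z * p = x * y * (z * p) by ring.
  have -> : x * y * (z * p) = x * z' * (y * p) by rewrite Hz; ring.
  have -> : x * z' * (y * p) = y' * z' * (x * p) by rewrite Hy; ring.
  by rewrite Hx; ring.
by rewrite mulrBr mulrBl !mulrA (mul3_mod _ _ _ _ _ _ Ha Ha Hb)
  (mul3_mod _ _ _ _ _ _ Ha Hk Hl) mulrBl.
Qed.

Lemma cube_sum3 (r0 r1 r2 : S) : r0 * r0 = 0 -> r1 * r1 = 0 -> r2 * r2 = 0 ->
  (r0 + r1 + r2) ^+ 3 = 6 * (r0 * r1 * r2).
Proof. by move=> H0 H1 H2; ring: H0 H1 H2. Qed.

(** Trades a product of three different forms for cubes, each of which is a determinant; the seven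
    terms match those of [mixdet]. *)
Lemma polarize_cube (a b c : S) : 6 * (a * b * c) =
  (a + b + c) ^+ 3 - (a + b) ^+ 3 - (a + c) ^+ 3 - (b + c) ^+ 3 + a ^+ 3 + b ^+ 3 + c ^+ 3.
Proof. by ring. Qed.

Lemma common_factor_6 (a1 a2 a3 a4 a5 a6 a7 b : S) :
  6 * a1 * b - 6 * a2 * b - 6 * a3 * b - 6 * a4 * b + 6 * a5 * b + 6 * a6 * b + 6 * a7 * b =
  6 * ((a1 - a2 - a3 - a4 + a5 + a6 + a7) * b).
Proof. by ring. Qed.

End CommutativeIdentities.

(** * Mixed discriminants of 3x3 matrices *)

Section MixedDiscriminant.

Lemma det3E (S : comNzRingType) (A : 'M[S]_3) :
  \det A = A 0 0 * (A 1 1 * A 2 2 - A 1 2 * A 2 1)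
     - A 0 1 * (A 1 0 * A 2 2 - A 1 2 * A 2 0)
     + A 0 2 * (A 1 0 * A 2 1 - A 1 1 * A 2 0).
Proof.
pose f i j := A (inord i) (inord j).
have AE i j : A i j = f (val i) (val j) by rewrite /f !inord_val.
rewrite (expand_det_row _ 0) !big_ord_recl big_ord0 /cofactor.
rewrite !(expand_det_row _ ord0) !big_ord_recl !big_ord0 /cofactor !det_mx11 !mxE !AE /=.
by rewrite /bump /=; ring.
Qed.

(* [c1 c2 - c3 = c3 (Lambda^2 E)], the eigenvalues of [Lambda^2 A] being those of [\tr A - A]. *)
Lemma schur21_det (S : comNzRingType) (A : 'M[S]_3) : schur21 A = \det ((\tr A)%:M - A).
Proof. by rewrite det3E /schur21 /mxtrace sum3E !mxE /= !mulr0n !mulr1n; ring. Qed.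

Lemma schur21_similar (S : comNzRingType) (P A Q : 'M[S]_3) :
  P *m Q = 1%:M -> schur21 (P *m A *m Q) = schur21 A.
Proof.
move=> PQ; have QP := mulmx1C PQ; rewrite !schur21_det.
have -> : \tr (P *m A *m Q) = \tr A by rewrite mxtrace_mulC mulmxA QP mul1mx.
have -> : (\tr A)%:M - P *m A *m Q = P *m ((\tr A)%:M - A) *m Q.
  by rewrite mulmxBr mulmxBl mul_mx_scalar -scalemxAl PQ scalemx1.
by rewrite !det_mulmx mulrAC -det_mulmx PQ det1 mul1r.
Qed.

(** The full polarisation of the determinant, without the usual division by 6: [mixdet X X X] is
    [6 * \det X]. *)
Definition mixdet (S : comNzRingType) (X Y Z : 'M[S]_3) : S :=
  \det (X + Y + Z) - \det (X + Y) - \det (X + Z) - \det (Y + Z)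
  + \det X + \det Y + \det Z.

Lemma mixdet_mul (S : comNzRingType) (P Q X Y Z : 'M[S]_3) :
  mixdet (P *m X *m Q) (P *m Y *m Q) (P *m Z *m Q) =
  \det P * \det Q * mixdet X Y Z.
Proof.
rewrite /mixdet -!mulmxDl -!mulmxDr !det_mulmx; ring.
Qed.

Lemma mixdet_diag (S : comNzRingType) (d : 'rV[S]_3) (X Y : 'M[S]_3) :
  mixdet (diag_mx d) X Y =
    d 0 0 * (X 1 1 * Y 2 2 + X 2 2 * Y 1 1 - X 1 2 * Y 2 1 - X 2 1 * Y 1 2)
  + d 0 1 * (X 0 0 * Y 2 2 + X 2 2 * Y 0 0 - X 0 2 * Y 2 0 - X 2 0 * Y 0 2)
  + d 0 2 * (X 0 0 * Y 1 1 + X 1 1 * Y 0 0 - X 0 1 * Y 1 0 - X 1 0 * Y 0 1).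
Proof. by rewrite /mixdet !det3E !mxE /= !mulr0n !mulr1n; ring. Qed.

Variable C : numClosedFieldType.

Definition qform n (X : 'M[C]_n) (t : 'rV[C]_n) : C := (t *m X *m t ^t*) 0 0.

Definition bform n (X : 'M[C]_n) (u v : 'rV[C]_n) : C := (u *m X *m v ^t*) 0 0.

Lemma bformE n (X : 'M[C]_n) u v :
  bform X u v = \sum_(j < n) \sum_(k < n) u 0 j * X j k * (v 0 k)^*.
Proof.
rewrite /bform mxE exchange_big; apply: eq_bigr => k _ /=.
by rewrite mxE mulr_suml; apply: eq_bigr => j _; rewrite !mxE.
Qed.

Lemma qform_lincomb n (X : 'M[C]_n) u v (a b : C) :
  qform X (a *: u + b *: v) =
  a * a^* * qform X u + a * b^* * bform X u v + b * a^* * bform X v u + b * b^* * qform X v.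
Proof.
rewrite /qform /bform !linearD /= map_mxD !linearZ /= !map_mxZ !mulmxDl !mulmxDr.
rewrite -!scalemxAl -!scalemxAr !mxE /=; ring.
Qed.

Lemma qform_mul m n (K : 'M[C]_(m, n)) (X : 'M[C]_n) (t : 'rV[C]_m) :
  qform (K *m X *m K ^t*) t = qform X (t *m K).
Proof. by rewrite /qform trmx_mul map_mxM !mulmxA. Qed.

Lemma bform_delta n (X : 'M[C]_n) i j : bform X (delta_mx 0 i) (delta_mx 0 j) = X i j.
Proof.
rewrite /bform trmx_delta map_delta_mx -rowE mxE (bigD1 j) //= !mxE !eqxx mulr1.
by rewrite big1 ?addr0 // => k /negPf kj; rewrite !mxE kj mulr0.
Qed.

Lemma qform_delta n (X : 'M[C]_n) i : qform X (delta_mx 0 i) = X i i.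
Proof. exact: bform_delta. Qed.

(** Complex polarisation: the values at [e_j + e_k] and [e_j + 'i e_k] determine both the sum and
    the difference of [X j k] and [X k j], so [X] need not be Hermitian. *)
Lemma qform_eq0 n (X : 'M[C]_n) : (forall t, qform X t = 0) -> X = 0.
Proof.
move=> X0; apply/matrixP => j k; rewrite [RHS]mxE.
have XE (a b : C) : a * b^* * X j k + b * a^* * X k j = 0.
  have := X0 (a *: delta_mx 0 j + b *: delta_mx 0 k).
  by rewrite qform_lincomb !X0 !bform_delta !mulr0 add0r addr0.
have := XE 1 1; have := XE 1 'i; rewrite conjCi rmorph1 !mulr1 !mul1r => Ei Es.
have : 2 * X j k = (X j k + X k j) + 'i * (- 'i * X j k + 'i * X k j).
  by have := sqrCi C; rewrite expr2 => Hi; ring: Hi.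
by rewrite Es Ei mulr0 addr0 => /eqP; rewrite mulf_eq0 pnatr_eq0 => /eqP.
Qed.

Lemma qform_conjT n (X : 'M[C]_n) t : qform (X ^t*) t = (qform X t)^*.
Proof.
have E (M : 'M[C]_1) : (M 0 0)^* = (M ^t*) 0 0 by rewrite 2!mxE.
by rewrite /qform E !trmx_mul !map_mxM trmxCK mulmxA.
Qed.

Lemma qform_conj_eq n (X Y : 'M[C]_n) :
  (forall t, qform Y t = (qform X t)^*) -> Y = X ^t*.
Proof.
move=> XY; apply/eqP; rewrite -subr_eq0; apply/eqP/qform_eq0 => t.
have -> : qform (Y - X ^t*) t = qform Y t - qform (X ^t*) t.
  by rewrite /qform mulmxBr mulmxBl !mxE.
by rewrite qform_conjT XY subrr.
Qed.

(** The arithmetic-geometric mean inequality is used in squared form, to avoid roots: (a1 b2 + a2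
    b1)^2 exceeds 4 a1 b1 a2 b2 by the square (a1 b2 - a2 b1)^2. *)
Lemma cross_term_le (a1 a2 b1 b2 k1 k2 : C) :
  0 <= a1 -> 0 <= a2 -> 0 <= b1 -> 0 <= b2 ->
  `|k1| ^+ 2 <= a1 * b1 -> `|k2| ^+ 2 <= a2 * b2 ->
  k1 * k2^* + k2 * k1^* <= a1 * b2 + a2 * b1.
Proof.
move=> a10 a20 b10 b20 h1 h2.
have zr : k1 * k2^* + k2 * k1^* \is Num.real.
  apply/CrealP; rewrite rmorphD !rmorphM /= !conjCK addrC.
  by rewrite [k2 * _]mulrC [k1 * _]mulrC.
apply: le_trans (real_ler_norm zr) _.
apply: le_trans (ler_normD _ _) _.
rewrite !normrM !norm_conjC [`|k2| * _]mulrC -mulr2n.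
have y0 : 0 <= a1 * b2 + a2 * b1 by rewrite addr_ge0 // mulr_ge0.
rewrite -(@ler_pXn2r _ 2%N) ?nnegrE ?mulrn_wge0 ?mulr_ge0 ?normr_ge0 //.
rewrite -subr_ge0.
have -> : (a1 * b2 + a2 * b1) ^+ 2 - (`|k1| * `|k2| *+ 2) ^+ 2 =
   (a1 * b2 - a2 * b1) ^+ 2 + 4 * (a1 * b1 * (a2 * b2) - `|k1| ^+ 2 * `|k2| ^+ 2).
  by rewrite -mulr_natr; ring.
rewrite addr_ge0 //.
  by rewrite real_exprn_even_ge0 // realB // ger0_real // mulr_ge0.
by rewrite mulr_ge0 // subr_ge0 ler_pM // ?exprn_ge0 // normr_ge0.
Qed.

(** Against a diagonal first argument the mixed discriminant is a [d]-weighted sum of 2x2 ones.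
    Off-diagonal entries of [B] would meet those of a diagonal matrix and disappear, and those of
    [K] appear only as [|K i j|^2], added with weight [d]. What remains is [cross_term_le] on
    diagonal entries. *)
Lemma mixdet_diag_ge0 (d : 'rV[C]_3) (B K : 'M[C]_3) :
  (forall i, 0 <= d 0 i) -> (forall i, 0 <= B i i) ->
  (forall i, `|K i i| ^+ 2 <= d 0 i * B i i) ->
  0 <= mixdet (diag_mx d) (diag_mx d) B - mixdet (diag_mx d) K (K ^t*).
Proof.
move=> d0 B0 K2.
have cr i j : 0 <= d 0 i * B j j + d 0 j * B i i - (K i i * (K j j)^* + K j j * (K i i)^*).
  by rewrite subr_ge0; apply: cross_term_le.
have -> : mixdet (diag_mx d) (diag_mx d) B - mixdet (diag_mx d) K (K ^t*) =
   d 0 0 * (d 0 1 * B 2 2 + d 0 2 * B 1 1 - (K 1 1 * (K 2 2)^* + K 2 2 * (K 1 1)^*))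
 + d 0 1 * (d 0 0 * B 2 2 + d 0 2 * B 0 0 - (K 0 0 * (K 2 2)^* + K 2 2 * (K 0 0)^*))
 + d 0 2 * (d 0 0 * B 1 1 + d 0 1 * B 0 0 - (K 0 0 * (K 1 1)^* + K 1 1 * (K 0 0)^*))
 + (d 0 0 * (K 1 2 * (K 1 2)^* + K 2 1 * (K 2 1)^*)
 + d 0 1 * (K 0 2 * (K 0 2)^* + K 2 0 * (K 2 0)^*)
 + d 0 2 * (K 0 1 * (K 0 1)^* + K 1 0 * (K 1 0)^*)).
  by rewrite !mixdet_diag !mxE /= !mulr0n !mulr1n; ring.
have mc (x : C) : 0 <= x * x^* by rewrite mul_conjC_ge0.
by rewrite !addr_ge0 // mulr_ge0 // addr_ge0.
Qed.

(** Bounds at single vectors [t] suffice: once [A] is unitarily diagonalised, only the diagonal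
    entries of [B] and [K] have to be controlled, and these are values at eigenvectors of [A]. *)
Lemma mixdet_ge0 (A B K K' : 'M[C]_3) :
  (forall t, 0 <= qform A t) -> (forall t, 0 <= qform B t) ->
  (forall t, qform K' t = (qform K t)^*) ->
  (forall t, `|qform K t| ^+ 2 <= qform A t * qform B t) ->
  0 <= mixdet A A B - mixdet A K K'.
Proof.
move=> A0 B0 KK' K2.
have hA : A = A ^t* by apply: qform_conj_eq => t; rewrite geC0_conj.
have nA : A \is normalmx by apply/normalmxP; rewrite -hA.
have [P uP [d Ad]] : exists2 P : 'M[C]_3, P \is unitarymx &
    exists d, A = P ^t* *m diag_mx d *m P.
  exists (spectralmx A); first exact: spectral_unitarymx.
  exists (spectral_diag A); rewrite -(invmx_unitary (spectral_unitarymx A)).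
  exact/orthomx_spectralP.
have PP : P *m P ^t* = 1%:M by apply/unitarymxP.
have PP' : P ^t* *m P = 1%:M by apply: mulmx1C.
pose T (X : 'M[C]_3) := P *m X *m P ^t*.
have TK X : X = P ^t* *m T X *m P.
  by rewrite /T !mulmxA PP' mul1mx -mulmxA PP' mulmx1.
have TA : T A = diag_mx d.
  by rewrite /T Ad !mulmxA PP mul1mx -mulmxA PP mulmx1.
have TK' : T K' = (T K) ^t*.
  by apply: qform_conj_eq => t; rewrite !qform_mul.
have Td X i : qform (T X) (delta_mx 0 i) = T X i i by rewrite qform_delta.
have mixT X Y Z : mixdet X Y Z = \det (P ^t*) * \det P * mixdet (T X) (T Y) (T Z).
  by rewrite -mixdet_mul -!TK.
rewrite (mixT A A B) (mixT A K K') -mulrBr TA TK'.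
have -> : \det (P ^t*) * \det P = 1 by rewrite -det_mulmx PP' det1.
rewrite mul1r; apply: mixdet_diag_ge0 => i.
- by have := A0 (delta_mx 0 i *m P); rewrite -qform_mul -/(T A) TA qform_delta mxE eqxx mulr1n.
- by rewrite -Td qform_mul.
- have := K2 (delta_mx 0 i *m P); rewrite -!qform_mul -/(T A) -/(T B) -/(T K) TA !qform_delta.
  by rewrite [diag_mx d i i]mxE eqxx mulr1n.
Qed.

End MixedDiscriminant.

(** * Forms of type (1,1) *)

Section Pairings.
Variables (R : realType) (m : nat).

Definition pairing n (g h : 'I_n -> ext R m) (X : 'M[R[i]]_n) : ext R m :=
  \sum_(j < n) \sum_(k < n) X j k *: wedge (g j) (h k).

Lemma pairing_base_change n (g h : 'I_n -> ext R m) (P Q X : 'M[R[i]]_n) :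
  pairing (fun j => \sum_(l < n) P j l *: g l) (fun k => \sum_(l < n) Q k l *: h l) X =
  pairing g h (P^T *m X *m Q).
Proof.
rewrite /pairing.
transitivity (\sum_(j < n) \sum_(k < n) \sum_(a < n) \sum_(b < n)
    (P j a * X j k * Q k b) *: wedge (g a) (h b)).
  apply: eq_bigr => j _; apply: eq_bigr => k _.
  rewrite wedge_suml scaler_sumr; apply: eq_bigr => a _.
  rewrite wedge_sumr scaler_sumr; apply: eq_bigr => b _.
  by rewrite wedgeZl wedgeZr !scalerA; congr (_ *: _); ring.
under eq_bigr do rewrite exchange_big /=.
rewrite exchange_big /=; apply: eq_bigr => a _.
under eq_bigr do rewrite exchange_big /=.
rewrite exchange_big /=; apply: eq_bigr => b _.
rewrite [in RHS]mxE scaler_suml exchange_big /=; apply: eq_bigr => k _.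
by rewrite [in RHS]mxE mulr_suml scaler_suml; apply: eq_bigr => j _; rewrite mxE.
Qed.

Definition pair11 (x y : ext R m) : even_ext R m :=
  locked (fun x y : ext R m => to_even ('i *: wedge x y)) x y.

Lemma even_val_pair11 x y : ext_parity true x -> ext_parity true y ->
  even_val (pair11 x y) = 'i *: wedge x y.
Proof.
move=> px py; rewrite /pair11 -lock; apply/to_evenK/ext_parityZ.
exact: (@ext_parity_wedge _ _ true true).
Qed.

(** The factor ['i ^+ 2] cancels the sign from exchanging [y] and [z]. *)
Lemma pair11_mul (x y z t : ext R m) :
  ext_parity true x -> ext_parity true y -> ext_parity true z -> ext_parity true t ->
  even_val (pair11 x y * pair11 z t) = wedge (wedge x z) (wedge y t).
Proof.
move=> px py pz pt; rewrite even_valM (even_val_pair11 px py) (even_val_pair11 pz pt).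
rewrite wedgeZl wedgeZr scalerA -expr2 sqrCi -(wedgeA x y) (wedgeA y z t) (wedge_oddC py pz).
by rewrite -[- wedge z y]scaleN1r wedgeZl wedgeZr scalerA mulrNN mulr1 scale1r !wedgeA.
Qed.

Variables (x y : nat -> ext R m).
Hypotheses (px : forall j, ext_parity true (x j)) (py : forall j, ext_parity true (y j)).

Lemma pair11_row0 j k l : pair11 (x j) (y k) * pair11 (x j) (y l) = 0.
Proof.
apply/val_inj; rewrite [LHS](pair11_mul (@px j) (@py k) (@px j) (@py l)).
by rewrite (wedge_odd_sqr (@px j)) wedge0l.
Qed.

Lemma pair11_col0 j k l : pair11 (x j) (y l) * pair11 (x k) (y l) = 0.
Proof.
apply/val_inj; rewrite [LHS](pair11_mul (@px j) (@py l) (@px k) (@py l)).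
by rewrite (wedge_odd_sqr (@py l)) wedge0r.
Qed.

Lemma pair11_swap j k l r :
  pair11 (x j) (y l) * pair11 (x k) (y r) = - (pair11 (x j) (y r) * pair11 (x k) (y l)).
Proof.
apply/val_inj; rewrite [RHS]even_valN [LHS](pair11_mul (@px j) (@py l) (@px k) (@py r)).
rewrite (pair11_mul (@px j) (@py r) (@px k) (@py l)).
by rewrite (wedge_oddC (@py l) (@py r)) -scaleN1r wedgeZr scaleN1r.
Qed.

(** The families are indexed by [nat] so that three consecutive covectors of a longer coframe can be
    used by shifting the index. *)
Definition block_form (X : 'M[R[i]]_3) : even_ext R m :=
  \sum_(j < 3) \sum_(k < 3) even_scal m (X j k) * pair11 (x j) (y k).

Lemma block_formD X Y : block_form (X + Y) = block_form X + block_form Y.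
Proof.
rewrite /block_form -big_split; apply: eq_bigr => j _; rewrite -big_split.
by apply: eq_bigr => k _; rewrite mxE rmorphD mulrDl.
Qed.

(** Each row sum is a multiple of the single covector [x j], so it squares to zero; the cube is
    therefore 6 times the product of the rows, and antisymmetry in the [y k] turns that product into
    a determinant. *)
Lemma block_form_cube X :
  block_form X ^+ 3 = 6 * even_scal m (\det X) *
    (pair11 (x 0) (y 0) * pair11 (x 1) (y 1) * pair11 (x 2) (y 2)).
Proof.
pose row j := \sum_(k < 3) even_scal m (X j k) * pair11 (x j) (y k).
have row2 j : row j * row j = 0.
  rewrite /row mulr_suml big1 // => k _; rewrite mulr_sumr big1 // => l _.
  by rewrite mulrACA pair11_row0 mulr0.
have -> : block_form X = row 0 + row 1 + row 2 by rewrite /block_form sum3E.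
rewrite (cube_sum3 (row2 0) (row2 1) (row2 2)) -[RHS]mulrA; congr (6 * _).
pose c j k := even_scal m (X j k); pose p j k := pair11 (x j) (y k).
have rowE j : row j = c j 0 * p j 0 + c j 1 * p j 1 + c j 2 * p j 2.
  by rewrite /row sum3E.
rewrite (rowE 0) (rowE 1) (rowE 2) pair_det.
- congr (_ * _); rewrite det3E /c.
  by rewrite rmorphD rmorphB (rmorphM _ (X 0 0)) (rmorphM _ (X 0 1)) (rmorphM _ (X 0 2))
    !rmorphB !rmorphM.
all: first [exact: pair11_col0 | exact: pair11_swap].
Qed.

Lemma block_form_mul X Y Z :
  block_form X * block_form Y * block_form Z = even_scal m (mixdet X Y Z) *
    (pair11 (x 0) (y 0) * pair11 (x 1) (y 1) * pair11 (x 2) (y 2)).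
Proof.
set p := pair11 _ _ * _ * _.
have six0 : (6 : R[i]) != 0 by rewrite pnatr_eq0.
apply: (even_scal_inj six0); rewrite rmorph_nat.
rewrite polarize_cube -(block_formD X Y) -(block_formD X Z) -(block_formD Y Z).
rewrite -(block_formD (X + Y) Z) 7!block_form_cube -/p /mixdet.
rewrite 3!(rmorphD (even_scal m)) 3!(rmorphB (even_scal m)).
exact: common_factor_6.
Qed.

End Pairings.

(** * Conjugation and coframes *)

Section FormsAtAPoint.
Variables (R : realType) (n : nat).

Lemma ext_parity_dz j : ext_parity true (dz R j : ext R (n + n)).
Proof. exact: ext_parity_gen. Qed.

Lemma ext_parity_dzbar j : ext_parity true (dzbar R j : ext R (n + n)).
Proof. exact: ext_parity_gen. Qed.

(** Holds by conversion; it gives conjugation the multiplicativity proved for [ext_hom]. *)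
Lemma conj_form_hom (w : ext R (n + n)) :
  conj_form w = ext_hom (Num.conj : {rmorphism R[i] -> R[i]})
    (fun k => ext_gen R (conj_index k)) w.
Proof. by []. Qed.

Let conj_odd k : ext_parity true (ext_gen R (conj_index k) : ext R (n + n)).
Proof. exact: ext_parity_gen. Qed.

Lemma conj_form0 : conj_form 0 = 0 :> ext R (n + n).
Proof. by rewrite conj_form_hom ext_hom0. Qed.

Lemma conj_formD (u v : ext R (n + n)) : conj_form (u + v) = conj_form u + conj_form v.
Proof. by rewrite !conj_form_hom ext_homD. Qed.

Lemma conj_formZ a (u : ext R (n + n)) : conj_form (a *: u) = a^* *: conj_form u.
Proof. by rewrite !conj_form_hom ext_homZ. Qed.

Lemma conj_form_sum T (r : seq T) (P : pred T) (F : T -> ext R (n + n)) :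
  conj_form (\sum_(i <- r | P i) F i) = \sum_(i <- r | P i) conj_form (F i).
Proof. by apply: (big_morph (@conj_form R n)); [exact: conj_formD|exact: conj_form0]. Qed.

Lemma conj_form_wedge (u v : ext R (n + n)) :
  conj_form (wedge u v) = wedge (conj_form u) (conj_form v).
Proof. rewrite !conj_form_hom; exact: ext_hom_wedge. Qed.

Lemma conj_form1 : conj_form (ext1 R (n + n)) = ext1 R (n + n).
Proof. rewrite conj_form_hom; exact: ext_hom1. Qed.

Lemma conj_form_prod T (r : seq T) (P : pred T) (F : T -> ext R (n + n)) :
  conj_form (\big[@wedge R (n + n)/ext1 R (n + n)]_(i <- r | P i) F i) =
  \big[@wedge R (n + n)/ext1 R (n + n)]_(i <- r | P i) conj_form (F i).
Proof. by apply: (big_morph (@conj_form R n)); [exact: conj_form_wedge|exact: conj_form1]. Qed.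

Lemma conj_form_dz j : conj_form (dz R j) = dzbar R j :> ext R (n + n).
Proof.
by rewrite conj_form_hom ext_hom_gen /conj_index (unsplitK (inl j)).
Qed.

Lemma conj_form_dzbar j : conj_form (dzbar R j) = dz R j :> ext R (n + n).
Proof.
by rewrite conj_form_hom ext_hom_gen /conj_index (unsplitK (inr j)).
Qed.

Lemma conj_linear_form (b : 'rV[R[i]]_n) :
  conj_form (linear_form b) = \sum_(j < n) (b 0 j)^* *: dzbar R j.
Proof.
rewrite conj_form_sum; apply: eq_bigr => j _.
by rewrite conj_formZ conj_form_dz.
Qed.

Lemma ext_parity_linear_form (b : 'rV[R[i]]_n) : ext_parity true (linear_form b).
Proof. by apply: ext_parity_sum => j _; apply: ext_parityZ; exact: ext_parity_dz. Qed.

Lemma ext_parity_conj_linear_form (b : 'rV[R[i]]_n) :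
  ext_parity true (conj_form (linear_form b)).
Proof.
rewrite conj_linear_form; apply: ext_parity_sum => j _.
by apply: ext_parityZ; exact: ext_parity_dzbar.
Qed.

Lemma linear_form0 : linear_form (0 : 'rV[R[i]]_n) = 0.
Proof. by rewrite /linear_form big1 // => j _; rewrite mxE scale0r. Qed.

Lemma linear_form_mul q (L : 'M[R[i]]_q) (G : 'M[R[i]]_(q, n)) s :
  linear_form (row s (L *m G)) = \sum_(t < q) L s t *: linear_form (row t G).
Proof.
rewrite /linear_form; under [RHS]eq_bigr do rewrite scaler_sumr.
rewrite exchange_big; apply: eq_bigr => j _ /=.
rewrite 2!mxE scaler_suml; apply: eq_bigr => t _.
by rewrite scalerA; congr (_ *: _); rewrite mxE.
Qed.

Definition volume_form : ext R (n + n) :=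
  \big[@wedge R (n + n)/ext1 R (n + n)]_(j < n) ('i *: wedge (dz R j) (dzbar R j)).

(* [L] acts on [q] linear forms by [det L], hence on this product by [|det L|^2]. *)
Lemma linear_form_prod_mul q (L : 'M[R[i]]_q) : exists d : R[i],
  forall G : 'M[R[i]]_(q, n),
  let b := \big[@wedge R (n + n)/ext1 R (n + n)]_(s < q) linear_form (row s (L *m G)) in
  'i ^+ (q ^ 2)%N *: wedge b (conj_form b) =
  (d * d^*) *: \big[@wedge R (n + n)/ext1 R (n + n)]_(s < q)
     ('i *: wedge (linear_form (row s G)) (conj_form (linear_form (row s G)))).
Proof.
have [d dP] := wedge_comb L; exists d => G b.
have -> : b = d *: \big[@wedge R (n + n)/ext1 R (n + n)]_(s < q) linear_form (row s G).
  rewrite -dP; last by move=> t; exact: ext_parity_linear_form.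
  by apply: eq_bigr => s _; exact: linear_form_mul.
rewrite wedge_prod_pairs; last first.
- by move=> s; exact: ext_parity_conj_linear_form.
- by move=> s; exact: ext_parity_linear_form.
rewrite conj_formZ conj_form_prod wedgeZl wedgeZr !scalerA; congr (_ *: _).
by rewrite mulrC.
Qed.

Lemma linear_form_row1 j : linear_form (row j 1%:M) = dz R j :> ext R (n + n).
Proof.
rewrite /linear_form (bigD1 j) //= big1 => [|k kj].
  by rewrite !mxE eqxx scale1r addr0.
by rewrite !mxE eq_sym (negPf kj) scale0r.
Qed.

Definition herm_form (X : 'M[R[i]]_n) : even_ext R (n + n) :=
  locked (fun X : 'M[R[i]]_n => to_even ('i *: pairing (@dz R n) (@dzbar R n) X)) X.

Lemma ext_parity_pairing (g h : 'I_n -> ext R (n + n)) X :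
  (forall j, ext_parity true (g j)) -> (forall j, ext_parity true (h j)) ->
  ext_parity false (pairing g h X).
Proof.
move=> pg ph; apply: ext_parity_sum => j _; apply: ext_parity_sum => k _.
by apply: ext_parityZ; apply: (@ext_parity_wedge _ _ true true).
Qed.

Lemma even_val_herm_form X :
  even_val (herm_form X) = 'i *: pairing (@dz R n) (@dzbar R n) X.
Proof.
rewrite /herm_form -lock.
apply/to_evenK/ext_parityZ/ext_parity_pairing => j; first exact: ext_parity_dz.
exact: ext_parity_dzbar.
Qed.

Lemma herm_formP a X Y : herm_form (a *: X + Y) = even_scal _ a * herm_form X + herm_form Y.
Proof.
apply/val_inj; rewrite [RHS]even_valD even_val_scalM [LHS]even_val_herm_form.
rewrite (even_val_herm_form X) (even_val_herm_form Y) scalerA mulrC.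
rewrite -scalerA -scalerDr; congr (_ *: _).
rewrite /pairing scaler_sumr -big_split; apply: eq_bigr => j _.
rewrite /= scaler_sumr -big_split; apply: eq_bigr => k _.
by rewrite !mxE scalerDl scalerA.
Qed.

Lemma herm_form0 : herm_form 0 = 0.
Proof.
apply/val_inj; rewrite [LHS]even_val_herm_form /pairing.
rewrite big1 ?scaler0 // => j _; rewrite big1 // => k _.
by rewrite mxE scale0r.
Qed.

Lemma herm_formZ a X : herm_form (a *: X) = even_scal _ a * herm_form X.
Proof. by rewrite -[a *: X]addr0 herm_formP herm_form0 addr0. Qed.

Lemma herm_formD X Y : herm_form (X + Y) = herm_form X + herm_form Y.
Proof. by rewrite -[X]scale1r herm_formP rmorph1 mul1r scale1r. Qed.

Lemma herm_form_sum T (r : seq T) (P : pred T) (F : T -> 'M[R[i]]_n) :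
  herm_form (\sum_(i <- r | P i) F i) = \sum_(i <- r | P i) herm_form (F i).
Proof. by apply: (big_morph herm_form); [exact: herm_formD|exact: herm_form0]. Qed.

(** Two signs cancel: ['i] is sent to its opposite, and [dzbar /\ dz] is put back in order. *)
Lemma conj_herm_form X :
  conj_form (even_val (herm_form X)) = even_val (herm_form (X ^t*)).
Proof.
rewrite (even_val_herm_form X) (even_val_herm_form (X ^t*)) conj_formZ conjCi.
rewrite /pairing conj_form_sum.
under eq_bigr do rewrite conj_form_sum.
rewrite exchange_big scaler_sumr [RHS]scaler_sumr; apply: eq_bigr => k _.
rewrite scaler_sumr [RHS]scaler_sumr; apply: eq_bigr => j _.
rewrite conj_formZ conj_form_wedge conj_form_dz conj_form_dzbar !mxE.
rewrite (wedge_oddC (@ext_parity_dzbar j) (@ext_parity_dz k)).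
by rewrite -[- wedge _ _]scaleN1r !scalerA; congr (_ *: _); rewrite mulrN1 mulNr opprK.
Qed.

Section Coframe.
Variable U : 'M[R[i]]_n.
Hypothesis U_unit : U \in unitmx.
Definition coframe j := linear_form (row j U).

Definition coframe_pair j k := pair11 (coframe j) (conj_form (coframe k)).

(** The coefficients relative to the coframe given by the rows of [U]. The formula is a congruence M
    X M^*, so values of [qform] are carried to values of [qform]. *)
Definition coframe_coef (X : 'M[R[i]]_n) : 'M[R[i]]_n :=
  (invmx U)^T *m X *m ((invmx U)^T) ^t*.

Lemma herm_form_coframe X :
  herm_form X = \sum_(j < n) \sum_(k < n)
    even_scal _ (coframe_coef X j k) * coframe_pair j k.
Proof.
apply/val_inj; rewrite [LHS]even_val_herm_form [RHS]even_val_sum.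
have XE : U^T *m coframe_coef X *m map_mx Num.conj U = X.
  rewrite /coframe_coef !mulmxA -trmx_mul mulVmx // trmx1 mul1mx.
  by rewrite trmxK -mulmxA -map_mxM mulVmx // map_mx1 mulmx1.
rewrite -[in LHS]XE -pairing_base_change /pairing scaler_sumr; apply: eq_bigr => j _.
rewrite even_val_sum scaler_sumr; apply: eq_bigr => k _.
rewrite even_val_scalM.
rewrite (even_val_pair11 (@ext_parity_linear_form _) (@ext_parity_conj_linear_form _)).
rewrite scalerA mulrC -scalerA conj_linear_form; congr (_ *: (_ *: wedge _ _)).
  by apply: eq_bigr => l _; rewrite mxE.
by apply: eq_bigr => l _; rewrite !mxE.
Qed.

End Coframe.

End FormsAtAPoint.

(** * Positivity for one pair of vectors *)

Lemma big_ord_add3 (T : Type) (idx : T) (op : Monoid.law idx) q (F : 'I_q.+3 -> T) :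
  \big[op/idx]_(j < q.+3) F j =
  op (op (op (\big[op/idx]_(s < q) F (inord s)) (F (inord (q + 0)))) (F (inord (q + 1))))
     (F (inord (q + 2))).
Proof.
rewrite !big_ord_recr /= addn0 addn1 addn2.
congr (op (op (op _ (F _)) (F _)) (F _)).
- apply: eq_bigr => s _; congr (F _); apply/val_inj; rewrite /= inordK //.
  by have := ltn_ord s; lia.
all: by apply/val_inj; rewrite /= inordK //; lia.
Qed.

Lemma sum_last3 (V : nmodType) q (G : 'I_q.+3 -> 'I_q.+3 -> V) :
  (forall (s : 'I_q) k, G (inord s) k = 0) -> (forall (s : 'I_q) k, G k (inord s) = 0) ->
  \sum_(j < q.+3) \sum_(k < q.+3) G j k =
  \sum_(i < 3) \sum_(l < 3) G (inord (q + i)) (inord (q + l)).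
Proof.
move=> Gl Gr; have split3 (F : 'I_q.+3 -> V) : (forall s : 'I_q, F (inord s) = 0) ->
    \sum_(j < q.+3) F j = \sum_(i < 3) F (inord (q + i)).
  move=> F0; rewrite big_ord_add3 sum3E /= big1 ?add0r // => s _; exact: F0.
rewrite split3 => [|s]; first by apply: eq_bigr => i _; apply: split3 => s; exact: Gr.
by rewrite big1.
Qed.

Section TestPositivity.
Variables (R : realType) (q : nat).
Local Notation n := q.+3.
Local Notation S := (even_ext R (n + n)).

Definition last3 (X : 'M[R[i]]_n) : 'M[R[i]]_3 :=
  \matrix_(i, l) X (inord (q + i)) (inord (q + l)).

Lemma last3_mul (P X Q : 'M[R[i]]_n) : last3 (P *m X *m Q) =
  (\matrix_(i, a) P (inord (q + i)) a) *m X *m (\matrix_(a, i) Q a (inord (q + i))).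
Proof.
apply/matrixP => i l; rewrite !mxE; apply: eq_bigr => a _.
by rewrite !mxE; congr (_ * _); apply: eq_bigr => b _; rewrite mxE.
Qed.

Section Coframe.
Variable U : 'M[R[i]]_n.
Hypothesis U_unit : U \in unitmx.

Let x (j : nat) : ext R (n + n) := coframe U (inord j).
Let y (j : nat) : ext R (n + n) := conj_form (coframe U (inord j)).

Let x_odd j : ext_parity true (x j).
Proof. exact: ext_parity_linear_form. Qed.

Let y_odd j : ext_parity true (y j).
Proof. exact: ext_parity_conj_linear_form. Qed.

Definition coframe_test : S := \prod_(s < q) coframe_pair U (inord s) (inord s).

Let xc i := x (q + i).
Let yc i := y (q + i).

(** The factor ['i x_s /\ y_s] of the test form kills every pair that contains [x_s] or [y_s]. What
    survives is the restriction of the form to the common kernel of the first [q] covectors. *)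
Lemma herm_form_test X :
  herm_form X * coframe_test = block_form xc yc (last3 (coframe_coef U X)) * coframe_test.
Proof.
pose G (j k : 'I_n) := even_scal (n + n) (coframe_coef U X j k) *
  coframe_pair U j k * coframe_test.
have G0l (s : 'I_q) k : G (inord s) k = 0.
  rewrite /G /coframe_test (bigD1 s) //= mulrA -[X in X * _]mulrA /coframe_pair.
  have := @pair11_row0 _ _ x y (@x_odd) (@y_odd) s k s; rewrite /x /y inord_val => ->.
  by rewrite mulr0 mul0r.
have G0r (s : 'I_q) k : G k (inord s) = 0.
  rewrite /G /coframe_test (bigD1 s) //= mulrA -[X in X * _]mulrA /coframe_pair.
  have := @pair11_col0 _ _ x y (@x_odd) (@y_odd) k s s; rewrite /x /y inord_val => ->.
  by rewrite mulr0 mul0r.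
have -> : herm_form X * coframe_test = \sum_(j < n) \sum_(k < n) G j k.
  rewrite (herm_form_coframe U_unit X) mulr_suml; apply: eq_bigr => j _.
  by rewrite mulr_suml.
rewrite (sum_last3 G0l G0r).
rewrite /block_form mulr_suml; apply: eq_bigr => i _.
by rewrite mulr_suml; apply: eq_bigr => l _; rewrite mxE.
Qed.

Lemma plane_form_test A B K K' :
  (forall t, 0 <= qform A t) -> (forall t, 0 <= qform B t) ->
  (forall t, qform K' t = (qform K t)^*) ->
  (forall t, `|qform K t| ^+ 2 <= qform A t * qform B t) ->
  exists2 c : R[i], 0 <= c &
    even_val (herm_form A * (herm_form A * herm_form B - herm_form K * herm_form K') *
      coframe_test) = c *: volume_form R n.
Proof.
move=> A0 B0 KK' K2.
(* An abstract name for the block, which rewriting cannot unfold. *)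
have [b bdef] : exists b, forall X, b X = last3 (coframe_coef U X).
  by exists (fun X => last3 (coframe_coef U X)).
pose P : 'M[R[i]]_(3, n) := \matrix_(i, a) (invmx U)^T (inord (q + i)) a.
have bE X t : qform (b X) t = qform X (t *m P).
  rewrite -qform_mul bdef /coframe_coef last3_mul; congr (qform (_ *m _ *m _) t).
  by apply/matrixP => a i; rewrite !mxE.
have mix0 : 0 <= mixdet (b A) (b A) (b B) - mixdet (b A) (b K) (b K').
  apply: mixdet_ge0 => t; first by rewrite bE; exact: A0.
  - by rewrite bE; exact: B0.
  - by rewrite (bE K') (bE K); exact: KK'.
  by rewrite (bE K) (bE A) (bE B); exact: K2.
have [d dP] := linear_form_prod_mul n U.
(* The first factor is the coefficient in the coframe [U]; the second, a squared modulus, compares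
   the volume form of [U] with the standard one. *)
exists ((mixdet (b A) (b A) (b B) - mixdet (b A) (b K) (b K')) * (d * d^*)).
  by rewrite mulr_ge0 // mul_conjC_ge0.
have test X : herm_form X * coframe_test = block_form xc yc (b X) * coframe_test.
  by rewrite bdef; exact: herm_form_test.
rewrite (plane_form_mod (test A) (test B) (test K) (test K')).
rewrite (block_form_mul (fun j => @x_odd (q + j)) (fun j => @y_odd (q + j)) (b A) (b A) (b B)).
rewrite (block_form_mul (fun j => @x_odd (q + j)) (fun j => @y_odd (q + j)) (b A) (b K) (b K')).
rewrite -mulrBl -(rmorphB (even_scal (n + n))) -[_ * _ * coframe_test]mulrA even_val_scalM.
rewrite -scalerA; congr (_ *: _).
transitivity (even_val (\prod_(j < n) coframe_pair U j j)).
  by congr even_val; rewrite big_ord_add3 /= [LHS]mulrC !mulrA.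
rewrite even_val_prod.
transitivity (\big[@wedge R (n + n)/ext1 R (n + n)]_(j < n)
    ('i *: wedge (linear_form (row j U)) (conj_form (linear_form (row j U))))).
  apply: eq_bigr => j _; apply: even_val_pair11; first exact: ext_parity_linear_form.
  exact: ext_parity_conj_linear_form.
rewrite wedge_prod_pairs; last first.
- by move=> s; exact: ext_parity_conj_linear_form.
- by move=> s; exact: ext_parity_linear_form.
have volE : \big[@wedge R (n + n)/ext1 R (n + n)]_(j < n)
    ('i *: wedge (linear_form (row j 1%:M)) (conj_form (linear_form (row j 1%:M)))) =
    volume_form R n.
  by apply: eq_bigr => j _; rewrite linear_form_row1 conj_form_dz.
rewrite -conj_form_prod; have := dP 1%:M; rewrite mulmx1 => ->.
by rewrite volE.
Qed.

End Coframe.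

(** The rank factorisation writes the [beta s] as combinations of the rows of [G]: first rows of an
    invertible matrix, then zeros. Below full rank a zero row makes the test form vanish; at full
    rank the rows of [G] begin a coframe, and [plane_form_test] applies. *)
Lemma plane_form_positive (beta : 'I_q -> 'rV[R[i]]_n) A B K K' :
  (forall t, 0 <= qform A t) -> (forall t, 0 <= qform B t) ->
  (forall t, qform K' t = (qform K t)^*) ->
  (forall t, `|qform K t| ^+ 2 <= qform A t * qform B t) ->
  let b := \big[@wedge R (n + n)/ext1 R (n + n)]_(s < q) linear_form (beta s) in
  exists2 c : R[i], 0 <= c &
    wedge (even_val (herm_form A * (herm_form A * herm_form B - herm_form K * herm_form K')))
      ('i ^+ (q ^ 2)%N *: wedge b (conj_form b)) = c *: volume_form R n.
Proof.
move=> A0 B0 KK' K2 b.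
pose M : 'M[R[i]]_(q, n) := \matrix_s beta s.
pose G : 'M[R[i]]_(q, n) := pid_mx (\rank M) *m row_ebase M.
have [d dP] := linear_form_prod_mul n (col_ebase M).
have bE : b = \big[@wedge R (n + n)/ext1 R (n + n)]_(s < q)
    linear_form (row s (col_ebase M *m G)).
  by apply: eq_bigr => s _; rewrite /G mulmxA mulmx_ebase rowK.
have {dP} := dP G; rewrite -bE => ->; rewrite wedgeZr.
have -> : \big[@wedge R (n + n)/ext1 R (n + n)]_(s < q)
     ('i *: wedge (linear_form (row s G)) (conj_form (linear_form (row s G)))) =
    even_val (\prod_(s < q) pair11 (linear_form (row s G)) (conj_form (linear_form (row s G)))).
  rewrite even_val_prod; apply: eq_bigr => s _; apply/esym/even_val_pair11.
    exact: ext_parity_linear_form.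
  exact: ext_parity_conj_linear_form.
rewrite -even_valM.
have [rq|rq] := ltnP (\rank M) q.
  exists 0 => //; rewrite scale0r (bigD1 (Ordinal rq)) //=.
  have -> : linear_form (row (Ordinal rq) G) = 0.
    have -> : row (Ordinal rq) G = 0.
      apply/rowP => j; rewrite !mxE big1 // => k _.
      by rewrite !mxE /= ltnn andbF mul0r.
    exact: linear_form0.
  have -> : pair11 0 (conj_form 0) = 0 :> S.
    apply/val_inj; rewrite [LHS]even_val_pair11.
    - by rewrite wedge0l scaler0.
    - exact: ext_parity0.
    - by rewrite conj_form0; exact: ext_parity0.
  by rewrite even_val0 wedge0l wedge0r scaler0.
have [c c0 cE] := plane_form_test (row_ebase_unit M) A0 B0 KK' K2.
exists (d * d^* * c); first by rewrite mulr_ge0 // mul_conjC_ge0.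
suff prodE : \prod_(s < q) pair11 (linear_form (row s G)) (conj_form (linear_form (row s G))) =
    coframe_test (row_ebase M) by rewrite prodE cE scalerA.
apply: eq_bigr => s _; rewrite /coframe_pair /coframe.
suff -> : row s G = row (inord s) (row_ebase M) by [].
have sn : (s < n)%N by apply: leq_trans (ltn_ord s) _; rewrite -addn3 leq_addr.
apply/rowP => j; rewrite !mxE (bigD1 (inord s)) //= big1 => [|k ks].
  by rewrite !mxE inordK // eqxx (leq_trans (ltn_ord s) rq) mul1r addr0.
rewrite !mxE; have -> : (s == k :> nat) = false; last by rewrite mul0r.
by apply: contraNF ks => /eqP sk; apply/eqP/val_inj; rewrite /= inordK.
Qed.

End TestPositivity.

(** * Curvature tensors *)

Section PositiveForms.
Variable C : numClosedFieldType.

Lemma psd_hermitian n (X : 'M[C]_n) : (forall t, 0 <= qform X t) -> X = X ^t*.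
Proof. by move=> X0; apply: qform_conj_eq => t; rewrite geC0_conj. Qed.

Lemma psd_bformC n (X : 'M[C]_n) u v : (forall t, 0 <= qform X t) ->
  bform X v u = (bform X u v)^*.
Proof.
move=> /psd_hermitian XE; rewrite !bformE rmorph_sum exchange_big /=.
apply: eq_bigr => j _; rewrite rmorph_sum; apply: eq_bigr => k _.
have -> : X k j = (X j k)^*.
  by have := congr1 (fun M : 'M[C]_n => M k j) XE; rewrite !mxE.
by rewrite !rmorphM /= conjCK; ring.
Qed.

Lemma psd_cauchy n (X : 'M[C]_n) u v : (forall t, 0 <= qform X t) ->
  `|bform X u v| ^+ 2 <= qform X u * qform X v.
Proof.
move=> X0; have vu := psd_bformC u v X0.
set c := bform X u v in vu *; set a := qform X u; set b := qform X v.
have a0 : 0 <= a by exact: X0. have b0 : 0 <= b by exact: X0.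
(* The value of [qform X] at [r u - s c v]. Keeping both weights handles [b = 0] as well, where the
   usual minimiser would divide by [b]. *)
have quad (r s : C) : 0 <= r -> 0 <= s ->
    0 <= r ^+ 2 * a - 2 * r * s * `|c| ^+ 2 + s ^+ 2 * `|c| ^+ 2 * b.
  move=> r0 s0; have := X0 (r *: u + (- (s * c)) *: v).
  rewrite qform_lincomb vu -/a -/b -/c rmorphN rmorphM /= !(geC0_conj r0) !(geC0_conj s0) normCK.
  by congr (0 <= _); ring.
have [b00|bn0] := eqVneq b 0.
  rewrite b00 mulr0; have [c0|cn0] := eqVneq (`|c| ^+ 2) 0; first by rewrite c0.
  have c2 : 0 < `|c| ^+ 2 by rewrite lt0r cn0 exprn_ge0 // normr_ge0.
  (* With [b = 0] and [r = 1], this [s] makes the expression equal to a - (a + 1) = -1, a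
     contradiction. *)
  have s0 : 0 <= (a + 1) / (2 * `|c| ^+ 2).
    by rewrite divr_ge0 ?addr_ge0 ?ler01 // mulr_ge0 ?ler0n // ltW.
  have := quad 1 _ ler01 s0; rewrite b00 mulr0 addr0 expr1n mul1r.
  have -> : 2 * 1 * ((a + 1) / (2 * `|c| ^+ 2)) * `|c| ^+ 2 = a + 1.
    by rewrite mulr1 [2 * _]mulrC -mulrA divfK // mulf_neq0 // pnatr_eq0.
  by rewrite opprD addrA subrr add0r oppr_ge0 => /(lt_le_trans ltr01); rewrite ltxx.
have bp : 0 < b by rewrite lt0r bn0.
have := quad b 1 b0 ler01; rewrite expr1n mul1r mulr1.
have -> : b ^+ 2 * a - 2 * b * `|c| ^+ 2 + `|c| ^+ 2 * b = b * (a * b - `|c| ^+ 2) by ring.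
by rewrite pmulr_rge0 // subr_ge0.
Qed.

(** Unitary diagonalisation followed by division by the square roots of the eigenvalues; the rows of
    [Q] are orthonormal for [H]. *)
Lemma orthonormal_basis n (H : 'M[C]_n) : (forall t, t != 0 -> 0 < qform H t) ->
  exists2 Q : 'M[C]_n, Q \in unitmx & Q *m H *m Q ^t* = 1%:M.
Proof.
move=> H0; have Hge t : 0 <= qform H t.
  by have [->|/H0/ltW//] := eqVneq t 0; rewrite /qform !mul0mx mxE.
have nH : H \is normalmx by apply/normalmxP; rewrite -(psd_hermitian Hge).
have uP := spectral_unitarymx H; set P := spectralmx H in uP.
set d := spectral_diag H.
have HE : H = P ^t* *m diag_mx d *m P.
  by rewrite -(invmx_unitary uP); exact/orthomx_spectralP.
have PP : P *m P ^t* = 1%:M by apply/unitarymxP.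
have PH : P *m H *m P ^t* = diag_mx d.
  by rewrite HE !mulmxA PP mul1mx -mulmxA PP mulmx1.
have d0 i : 0 < d 0 i.
  have := H0 (delta_mx 0 i *m P); rewrite -qform_mul PH qform_delta mxE eqxx mulr1n; apply.
  apply/negP => /eqP /(congr1 (mulmx^~ (P ^t*))); rewrite -mulmxA PP mulmx1 mul0mx.
  by move=> /matrixP/(_ 0 i)/eqP; rewrite !mxE !eqxx oner_eq0.
pose s : 'rV[C]_n := \row_i (sqrtC (d 0 i))^-1.
have sd i : s 0 i * d 0 i * s 0 i = 1.
  rewrite mxE -{2}(sqrtCK (d 0 i)) expr2 mulrA mulVf ?mul1r ?mulfV //.
    by rewrite sqrtC_eq0 gt_eqF.
  by rewrite sqrtC_eq0 gt_eqF.
exists (diag_mx s *m P).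
  rewrite unitmx_mul (unitarymx_unit uP) andbT unitmxE det_diag unitfE.
  by apply/prodf_neq0 => i _; rewrite mxE invr_eq0 sqrtC_eq0 gt_eqF.
have -> : (diag_mx s *m P) ^t* = P ^t* *m diag_mx s.
  rewrite trmx_mul map_mxM tr_diag_mx map_diag_mx; congr (_ *m diag_mx _).
  by apply/rowP => i; rewrite !mxE /= geC0_conj // invr_ge0 sqrtC_ge0 ltW.
rewrite mulmxA -(mulmxA (diag_mx s) P H) -(mulmxA (diag_mx s) (P *m H)) PH.
rewrite !mulmx_diag -diag_const_mx; congr diag_mx.
by apply/rowP => i; rewrite 2!mxE sd mxE.
Qed.

End PositiveForms.

Section CurvatureTensor.
Variables (R : realType) (n : nat).
Local Notation S := (even_ext R (n + n)).
Implicit Types (Th : 'I_n -> 'I_n -> 'M[R[i]]_3) (u v : 'I_3 -> R[i]).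

(** In an orthonormal frame these are the coefficients of the form [<Theta v, u>]; note the order of
    the arguments. *)
Definition tensor_coef Th u v : 'M[R[i]]_n :=
  \matrix_(j, k) \sum_(b < 3) \sum_(c < 3) (u b)^* * Th j k b c * v c.

Definition tensor_form Th : 'M[S]_3 :=
  \matrix_(b, c) herm_form (\matrix_(j, k) Th j k b c).

Lemma sesq_tensor_form Th u v :
  sesq (tensor_form Th) (fun b => even_scal _ (u b)^*) (fun c => even_scal _ (v c)) =
  herm_form (tensor_coef Th u v).
Proof.
have -> : tensor_coef Th u v =
    \sum_(b < 3) \sum_(c < 3) ((u b)^* * v c) *: \matrix_(j, k) Th j k b c.
  apply/matrixP => j k; rewrite mxE summxE; apply: eq_bigr => b _.
  by rewrite summxE; apply: eq_bigr => c _; rewrite !mxE; ring.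
rewrite herm_form_sum /sesq; apply: eq_bigr => b _.
rewrite herm_form_sum; apply: eq_bigr => c _.
by rewrite herm_formZ rmorphM mxE mulrAC.
Qed.

(** Exchanges the two roles of the tensor: for a fixed tangent vector [t] it becomes a sesquilinear
    form on the fibre, which semipositivity on decomposables makes nonnegative. *)
Lemma tensor_coef_bform Th u v (t : 'rV[R[i]]_n) :
  qform (tensor_coef Th u v) t =
  bform (\matrix_(c, b) \sum_(j < n) \sum_(k < n) t 0 j * Th j k b c * (t 0 k)^*)
    (\row_c v c) (\row_b u b).
Proof.
rewrite -[qform _ _]/(bform _ _ _) !bformE.
transitivity (\sum_(j < n) \sum_(k < n) \sum_(b < 3) \sum_(c < 3)
  v c * (t 0 j * Th j k b c * (t 0 k)^*) * (u b)^*).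
  apply: eq_bigr => j _; apply: eq_bigr => k _; rewrite mxE mulr_sumr mulr_suml.
  apply: eq_bigr => b _; rewrite mulr_sumr mulr_suml; apply: eq_bigr => c _; ring.
under eq_bigr do rewrite exchange_big /=.
rewrite exchange_big [RHS]exchange_big /=; apply: eq_bigr => b _.
under eq_bigr do rewrite exchange_big /=.
rewrite exchange_big /=; apply: eq_bigr => c _.
rewrite !mxE mulr_sumr mulr_suml; apply: eq_bigr => j _.
by rewrite mulr_sumr mulr_suml.
Qed.

Section Semipositive.
Variable Th : 'I_n -> 'I_n -> 'M[R[i]]_3.
Hypothesis Th_ge0 : forall v t, 0 <= qform (tensor_coef Th v v) t.

Let tensor_psd (t : 'rV[R[i]]_n) (w : 'rV[R[i]]_3) : 0 <=
  qform (\matrix_(c, b) \sum_(j < n) \sum_(k < n) t 0 j * Th j k b c * (t 0 k)^*) w.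
Proof.
have := Th_ge0 (fun b => w 0 b) t; rewrite tensor_coef_bform.
by have -> : \row_b w 0 b = w by apply/rowP => b; rewrite mxE.
Qed.

Lemma tensor_coefC u v t :
  qform (tensor_coef Th v u) t = (qform (tensor_coef Th u v) t)^*.
Proof. by rewrite !tensor_coef_bform; apply/psd_bformC/tensor_psd. Qed.

(** Cauchy-Schwarz in the fibre with [t] fixed, so that only decomposable tensors are involved; this
    feeds the last hypothesis of [mixdet_ge0]. *)
Lemma tensor_coef_cauchy u v t :
  `|qform (tensor_coef Th u v) t| ^+ 2 <=
  qform (tensor_coef Th u u) t * qform (tensor_coef Th v v) t.
Proof.
by rewrite !tensor_coef_bform mulrC; apply/psd_cauchy/tensor_psd.
Qed.

End Semipositive.

End CurvatureTensor.

(** * Positivity of the Schur form of a tensor *)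

Lemma cube_root_of_unity (C : numClosedFieldType) :
  exists2 w : C, w * w = -1 - w & w^* = -1 - w.
Proof.
pose s : C := sqrtC 3; have s2 : s * s = 3 by rewrite -expr2 sqrtCK.
have i2 : 'i * 'i = -1 :> C by rewrite -expr2 sqrCi.
have sr : s^* = s by rewrite geC0_conj // sqrtC_ge0 ler0n.
have two0 : (2 : C) != 0 by rewrite pnatr_eq0.
exists ((-1 + 'i * s) / 2).
  apply: (mulfI (mulf_neq0 two0 two0)).
  have -> : 2 * 2 * ((-1 + 'i * s) / 2 * ((-1 + 'i * s) / 2)) =
     (-1 + 'i * s) * (-1 + 'i * s) by field.
  have -> : 2 * 2 * (-1 - (-1 + 'i * s) / 2) = 2 * (-2 - (-1 + 'i * s)) by field.
  by ring: s2 i2.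
rewrite rmorphM fmorphV rmorphD rmorphN1 rmorphM rmorph_nat /= conjCi sr.
by field.
Qed.

Section Test.
Variables (R : realType) (q : nat).
Local Notation n := q.+3.
Local Notation S := (even_ext R (n + n)).
Variables (Th : 'I_n -> 'I_n -> 'M[R[i]]_3) (beta : 'I_q -> 'rV[R[i]]_n).
Hypothesis Th_ge0 : forall v t, 0 <= qform (tensor_coef Th v v) t.

Let b := \big[@wedge R (n + n)/ext1 R (n + n)]_(s < q) linear_form (beta s).

Definition test_ge0 (a : S) : Prop :=
  exists2 c : R[i], 0 <= c &
    wedge (even_val a) ('i ^+ (q ^ 2)%N *: wedge b (conj_form b)) = c *: volume_form R n.

Lemma test_ge0D x y : test_ge0 x -> test_ge0 y -> test_ge0 (x + y).
Proof.
move=> [c c0 cE] [d d0 dE]; exists (c + d); first exact: addr_ge0.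
by rewrite even_valD wedgeDl cE dE scalerDl.
Qed.

Lemma test_ge0Z a x : 0 <= a -> test_ge0 x -> test_ge0 (even_scal _ a * x).
Proof.
move=> a0 [c c0 cE]; exists (a * c); first exact: mulr_ge0.
by rewrite even_val_scalM wedgeZl cE scalerA.
Qed.

Lemma test_ge0_sum T (r : seq T) (P : pred T) (F : T -> S) :
  (forall i, P i -> test_ge0 (F i)) -> test_ge0 (\sum_(i <- r | P i) F i).
Proof.
move=> F0; apply: (big_ind test_ge0) => //; last exact: test_ge0D.
by exists 0 => //; rewrite even_val0 wedge0l scale0r.
Qed.

(** The pointwise equations let this apply to vectors of even forms however their scalars are
    written. *)
Lemma test_ge0_plane (u' u v' v : 'I_3 -> S) (U V : 'I_3 -> R[i]) :
  (forall j, u' j = even_scal _ (U j)^*) -> (forall j, u j = even_scal _ (U j)) ->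
  (forall j, v' j = even_scal _ (V j)^*) -> (forall j, v j = even_scal _ (V j)) ->
  test_ge0 (plane_form (tensor_form Th) u' u v' v).
Proof.
move=> /funext -> /funext -> /funext -> /funext ->.
rewrite /plane_form !sesq_tensor_form.
apply: plane_form_positive => t; try exact: Th_ge0.
- exact: tensor_coefC.
- exact: tensor_coef_cauchy.
Qed.

Lemma test_ge0_schur21 : test_ge0 (schur21 (tensor_form Th)).
Proof.
have [w w2 wc] := cube_root_of_unity R[i].
have wc' : (-1 - w)^* = w by rewrite rmorphB rmorphN1 /= wc opprB addrC subrK.
have Hw : even_scal (n + n) w * even_scal (n + n) w = - 1 - even_scal (n + n) w.
  by rewrite -rmorphM w2 rmorphB rmorphN1.
have w'E : - 1 - even_scal (n + n) w = even_scal (n + n) (-1 - w) by rewrite rmorphB rmorphN1.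
have n81 : (81 : R[i]) != 0 by rewrite pnatr_eq0.
have -> : schur21 (tensor_form Th) = even_scal _ 81^-1 * (81 * schur21 (tensor_form Th)).
  by rewrite -(rmorph_nat (even_scal (n + n))) mulrA -rmorphM mulVf // rmorph1 mul1r.
apply: test_ge0Z; first by rewrite invr_ge0 ler0n.
rewrite (schur21_plane_forms Hw) w'E; apply: test_ge0D; last first.
  rewrite -(rmorph_nat (even_scal (n + n))); apply: test_ge0Z; first exact: ler0n.
  apply: test_ge0_sum => i _; apply: test_ge0_sum => k _.
  apply: (@test_ge0_plane _ _ _ _ (fun j => (j == i)%:R) (fun j => (j == k)%:R)) => j;
    by rewrite ?rmorph_nat.
(* The conjugate of [w] is [-1 - w], so each pair consists of a number and its conjugate. Here the
   independent variables of the ring identity become conjugate to each other. *)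
have -> : [:: (1, 1); (even_scal (n + n) w, even_scal (n + n) (-1 - w));
    (even_scal (n + n) (-1 - w), even_scal (n + n) w)] =
    [seq (even_scal (n + n) z, even_scal (n + n) z^* ) | z <- [:: 1; w; -1 - w]].
  by rewrite /= conjC1 rmorph1 wc wc'.
rewrite big_map; apply: test_ge0_sum => t _.
rewrite big_map; apply: test_ge0_sum => r _ /=.
have vec3_map (f : R[i] -> S) x y z (u : 'I_3 -> S) : u = vec3 (f x) (f y) (f z) ->
    forall j, u j = f (vec3 x y z j).
  by move=> ->; case=> [[|[|[|]]]].
apply: test_ge0D.
- apply: (@test_ge0_plane _ _ _ _ (vec3 1 t r) (vec3 1 (t * w) (r * (-1 - w)))).
  + by apply: (vec3_map (fun z => even_scal _ z^*)); rewrite conjC1 rmorph1.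
  + by apply: vec3_map; rewrite rmorph1.
  + apply: (vec3_map (fun z => even_scal _ z^*)); rewrite conjC1 rmorph1.
    by rewrite !(rmorphM Num.conj) /= wc wc' !rmorphM.
  + by apply: vec3_map; rewrite rmorph1 !rmorphM.
- apply: (@test_ge0_plane _ _ _ _ (vec3 1 t r) (vec3 1 (t * (-1 - w)) (r * w))).
  + by apply: (vec3_map (fun z => even_scal _ z^*)); rewrite conjC1 rmorph1.
  + by apply: vec3_map; rewrite rmorph1.
  + apply: (vec3_map (fun z => even_scal _ z^*)); rewrite conjC1 rmorph1.
    by rewrite !(rmorphM Num.conj) /= wc wc' !rmorphM.
  + by apply: vec3_map; rewrite rmorph1 !rmorphM.
Qed.

End Test.

(** * Reality and bidegree of the Schur form *)

Section Reality.
Variables (R : realType) (n : nat).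
Local Notation S := (even_ext R (n + n)).

Definition conj_even (a : S) : S := locked (fun a : S => to_even (conj_form (even_val a))) a.

Lemma even_val_conj a : even_val (conj_even a) = conj_form (even_val a).
Proof.
rewrite /conj_even -lock; apply: to_evenK; rewrite conj_form_hom.
by apply: ext_parity_hom => [k|]; [exact: ext_parity_gen|exact: even_valP].
Qed.

Fact conj_even_zmod : zmod_morphism conj_even.
Proof.
move=> x y; apply/val_inj; rewrite [LHS]even_val_conj [RHS]even_valD even_valN.
rewrite (even_val_conj x) (even_val_conj y) even_valD even_valN conj_formD.
by rewrite -scaleN1r conj_formZ rmorphN1 scaleN1r.
Qed.

Fact conj_even_monoid : monoid_morphism conj_even.
Proof.
split; first by apply/val_inj; rewrite [LHS]even_val_conj even_val1 conj_form1.
move=> x y; apply/val_inj; rewrite [LHS]even_val_conj [RHS]even_valM.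
by rewrite (even_val_conj x) (even_val_conj y) even_valM conj_form_wedge.
Qed.

HB.instance Definition _ := GRing.isZmodMorphism.Build S S conj_even conj_even_zmod.
HB.instance Definition _ := GRing.isMonoidMorphism.Build S S conj_even conj_even_monoid.

Lemma conj_tensor_form (Th : 'I_n -> 'I_n -> 'M[R[i]]_3) :
  (forall v t, 0 <= qform (tensor_coef Th v v) t) ->
  map_mx conj_even (tensor_form Th) = (tensor_form Th)^T.
Proof.
move=> Th_ge0; apply/matrixP => c d; rewrite !mxE.
apply/val_inj; rewrite [LHS]even_val_conj conj_herm_form; congr (even_val (herm_form _)).
pose e (b : 'I_3) := fun j : 'I_3 => (j == b)%:R : R[i].
have eE a b : tensor_coef Th (e a) (e b) = \matrix_(j, k) Th j k a b.
  apply/matrixP => j k; rewrite !mxE (bigD1 a) //= (bigD1 b) //= /e !eqxx rmorph1 mul1r mulr1.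
  rewrite big1 ?addr0 => [|l /negPf lb]; last by rewrite lb mulr0.
  rewrite big1 ?addr0 // => l /negPf la.
  by rewrite big1 // => l' _; rewrite la rmorph0 !mul0r.
by rewrite -!eE; apply/esym/qform_conj_eq => t; exact: tensor_coefC.
Qed.

(** For a Hermitian tensor conjugation transposes the matrix of forms, and the polynomial [schur21]
    is invariant under transposition. *)
Lemma conj_schur21_tensor (Th : 'I_n -> 'I_n -> 'M[R[i]]_3) :
  (forall v t, 0 <= qform (tensor_coef Th v v) t) ->
  conj_form (even_val (schur21 (tensor_form Th))) = even_val (schur21 (tensor_form Th)).
Proof.
move=> /conj_tensor_form TE; rewrite -even_val_conj.
by rewrite -(schur21_map conj_even (tensor_form Th)) TE schur21_tr.
Qed.

(** Separates the bidegree into two additive statistics, to which the lemmas on [ext_graded]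
    apply. *)
Lemma has_bidegreeP p q (w : ext R (n + n)) : has_bidegree p q w <->
  ext_graded (fun K => #|[set j : 'I_n | lshift n j \in K]%SET|) p w /\
  ext_graded (fun K => #|[set j : 'I_n | rshift n j \in K]%SET|) q w.
Proof.
split=> [w0|[wp wq] K K0]; last by split; [exact: wp|exact: wq].
by split=> K /w0 [].
Qed.

Lemma cards_preim_setD (f : 'I_n -> 'I_(n + n)) (I K : {set 'I_(n + n)}) : I \subset K ->
  (#|[set j | f j \in I]%SET| + #|[set j | f j \in K :\: I]%SET|)%N = #|[set j | f j \in K]%SET|.
Proof.
move=> IK; have -> : [set j | f j \in K :\: I]%SET =
    ([set j | f j \in K] :\: [set j | f j \in I])%SET.
  by apply/finset.setP => j; rewrite !inE.
apply: cards_setD; apply/fintype.subsetP => j; rewrite !inE.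
exact: (fintype.subsetP IK).
Qed.

Lemma has_bidegree_wedge p q p' q' (u v : ext R (n + n)) :
  has_bidegree p q u -> has_bidegree p' q' v -> has_bidegree (p + p') (q + q') (wedge u v).
Proof.
move=> /has_bidegreeP[up uq] /has_bidegreeP[vp vq]; apply/has_bidegreeP.
by split; apply: ext_graded_wedge => // I K IK; apply: cards_preim_setD.
Qed.

Lemma has_bidegreeD p q (u v : ext R (n + n)) :
  has_bidegree p q u -> has_bidegree p q v -> has_bidegree p q (u + v).
Proof.
move=> /has_bidegreeP[up uq] /has_bidegreeP[vp vq]; apply/has_bidegreeP.
by split; apply: ext_gradedD.
Qed.

Lemma has_bidegreeZ p q a (u : ext R (n + n)) :
  has_bidegree p q u -> has_bidegree p q (a *: u).
Proof.
by move=> /has_bidegreeP[up uq]; apply/has_bidegreeP; split; apply: ext_gradedZ.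
Qed.

Lemma has_bidegreeN p q (u : ext R (n + n)) : has_bidegree p q u -> has_bidegree p q (- u).
Proof. by rewrite -scaleN1r; exact: has_bidegreeZ. Qed.

Lemma has_bidegree_herm (X : 'M[R[i]]_n) : has_bidegree 1 1 (even_val (herm_form X)).
Proof.
rewrite even_val_herm_form; apply: has_bidegreeZ.
have dz1 j : has_bidegree 1 0 (dz R j : ext R (n + n)).
  move=> K; rewrite ffunE; case: (K =P _) => [-> _|]; last by rewrite eqxx.
  split; first rewrite -(finset.cards1 j).
    by congr #|pred_of_set _|; apply/finset.setP => i; rewrite !inE eq_lshift.
  apply/eqP; rewrite finset.cards_eq0; apply/eqP/finset.setP => i.
  by rewrite !inE eq_rlshift.
have dzbar1 j : has_bidegree 0 1 (dzbar R j : ext R (n + n)).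
  move=> K; rewrite ffunE; case: (K =P _) => [-> _|]; last by rewrite eqxx.
  split; last first.
    rewrite -(finset.cards1 j).
    by congr #|pred_of_set _|; apply/finset.setP => i; rewrite !inE eq_rshift.
  apply/eqP; rewrite finset.cards_eq0; apply/eqP/finset.setP => i.
  by rewrite !inE eq_lrshift.
have dd1 (j k : 'I_n) : has_bidegree 1 1 (wedge (dz R j) (dzbar R k)).
  by have := has_bidegree_wedge (@dz1 j) (@dzbar1 k); rewrite addn0 add0n.
apply/has_bidegreeP; split; apply: ext_graded_sum => j _; apply: ext_graded_sum => k _.
- by apply: ext_gradedZ; have /has_bidegreeP[] := dd1 j k.
- by apply: ext_gradedZ; have /has_bidegreeP[] := dd1 j k.
Qed.

Lemma has_bidegree_schur21 (A : 'M[S]_3) :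
  (forall b c, has_bidegree 1 1 (even_val (A b c))) ->
  has_bidegree 3 3 (even_val (schur21 A)).
Proof.
move=> A1.
have A2 b c d e : has_bidegree 2 2 (even_val (A b c * A d e)).
  by rewrite even_valM; exact: (@has_bidegree_wedge 1 1 1 1).
have D p (x y : S) : has_bidegree p p (even_val x) -> has_bidegree p p (even_val y) ->
    has_bidegree p p (even_val (x + y)) by rewrite even_valD; exact: has_bidegreeD.
have B p (x y : S) : has_bidegree p p (even_val x) -> has_bidegree p p (even_val y) ->
    has_bidegree p p (even_val (x - y)).
  by move=> hx hy; apply: D => //; rewrite even_valN; exact: has_bidegreeN.
have M (x y : S) : has_bidegree 1 1 (even_val x) -> has_bidegree 2 2 (even_val y) ->
    has_bidegree 3 3 (even_val (x * y)) by rewrite even_valM; exact: has_bidegree_wedge.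
have m2 b c d e b' c' d' e' : has_bidegree 2 2 (even_val (A b c * A d e - A b' c' * A d' e')).
  exact: (B _ _ _ (A2 _ _ _ _) (A2 _ _ _ _)).
rewrite /schur21; apply: (B 3 _ _ (M _ _ _ _)).
- exact: (D _ _ _ (D _ _ _ (A1 _ _) (A1 _ _)) (A1 _ _)).
- exact: (D _ _ _ (D _ _ _ (m2 _ _ _ _ _ _ _ _) (m2 _ _ _ _ _ _ _ _)) (m2 _ _ _ _ _ _ _ _)).
- apply: (D 3 _ _ (B 3 _ _ (M _ _ _ _) (M _ _ _ _)) (M _ _ _ _)); try exact: A1; exact: m2.
Qed.

End Reality.

(** * Chern forms as traces of exterior powers *)

Lemma positive_schur21_tensor (R : realType) n (Th : 'I_n -> 'I_n -> 'M[R[i]]_3) :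
  (forall v t, 0 <= qform (tensor_coef Th v v) t) ->
  positive_form 3 (even_val (schur21 (tensor_form Th))).
Proof.
move=> Th_ge0; split.
- by apply: has_bidegree_schur21 => b c; rewrite mxE; exact: has_bidegree_herm.
- exact: conj_schur21_tensor.
move=> q qn; case: n / qn Th Th_ge0 => Th Th_ge0 beta b.
have [c c0 cE] := @test_ge0_schur21 R q Th beta Th_ge0.
(* Nonnegativity in [R[i]] includes reality, which supplies the real number required by
   [positive_volume]. *)
move: c0; rewrite lecE /= => /andP[/eqP imc rec].
exists (complex.Re c) => //; apply: etrans cE _; congr (_ *: _).
by case: (c) imc => cr ci /= ->.
Qed.

Section TraceOfExteriorPower.
Variables (R : realType) (m : nat).
Local Notation S := (even_ext R m).

Definition increasing k r (f : {ffun 'I_k -> 'I_r}) : bool :=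
  [forall l1 : 'I_k, forall l2 : 'I_k, (l1 < l2)%N ==> (f l1 < f l2)%N].

(** [ext_power] permutes the row indices where [\det] permutes the column indices, hence the
    transposition. *)
Lemma ext_power_det k r (A : 'M[S]_r) (f : {ffun 'I_k -> 'I_r}) :
  ext_power (map_mx (@even_val R m) A) f f =
  even_val (\det (\matrix_(l, l') A (f l) (f l'))).
Proof.
rewrite -det_tr /ext_power even_val_sum; apply: eq_bigr => s _.
rewrite -(rmorph_sign (even_scal m)) even_val_scalM even_val_prod; congr (_ *: _).
by apply: eq_bigr => l _; rewrite !mxE.
Qed.

Lemma tr_ext_power_minors k r (A : 'M[S]_r) :
  tr_ext_power k (map_mx (@even_val R m) A) = even_val
    (\sum_(f : {ffun 'I_k -> 'I_r} | increasing f) \det (\matrix_(l, l') A (f l) (f l'))).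
Proof. by rewrite even_val_sum; apply: eq_bigr => f _; exact: ext_power_det. Qed.

End TraceOfExteriorPower.

Section PrincipalMinors.
Variable S : comNzRingType.
Implicit Type A : 'M[S]_3.

Lemma sum_increasing1 A :
  \sum_(f : {ffun 'I_1 -> 'I_3} | increasing f) \det (\matrix_(l, l') A (f l) (f l')) =
  A 0 0 + A 1 1 + A 2 2.
Proof.
rewrite (reindex (fun i : 'I_3 => [ffun=> i])); last first.
  exists (fun f : {ffun 'I_1 -> 'I_3} => f 0) => [i _|f _]; first by rewrite ffunE.
  by apply/ffunP => j; rewrite ffunE (ord1 j).
rewrite -(sum3E (fun i => A i i)); apply: eq_big => [i|i _].
  by apply/'forall_forallP => l1 l2; rewrite (ord1 l1) (ord1 l2) ltnn.
by rewrite det_mx11 mxE !ffunE.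
Qed.

Lemma sum_increasing2 A :
  \sum_(f : {ffun 'I_2 -> 'I_3} | increasing f) \det (\matrix_(l, l') A (f l) (f l')) =
  A 0 0 * A 1 1 - A 0 1 * A 1 0 + (A 0 0 * A 2 2 - A 0 2 * A 2 0)
   + (A 1 1 * A 2 2 - A 1 2 * A 2 1).
Proof.
pose F (p : 'I_3 * 'I_3) : {ffun 'I_2 -> 'I_3} := [ffun l => if l == 0 then p.1 else p.2].
have F1 p : F p 1 = p.2 by rewrite ffunE.
have F0 p : F p 0 = p.1 by rewrite ffunE.
have ord2 (l : 'I_2) : l = 0 \/ l = 1.
  by case: l => [[|[|//]] ?]; [left|right]; apply/val_inj.
rewrite (reindex F); last first.
  exists (fun f : {ffun 'I_2 -> 'I_3} => (f 0, f 1)) => [p _|f _].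
    by rewrite F0 F1; case: p.
  by apply/ffunP => j; case: (ord2 j) => ->; rewrite ?F0 ?F1.
have incF p : increasing (F p) = (p.1 < p.2)%N.
  apply/'forall_forallP/idP => [/(_ 0 1)|lt12 l1 l2]; first by rewrite F0 F1.
  by case: (ord2 l1) => ->; case: (ord2 l2) => -> //; rewrite F0 F1 lt12.
have det2E (B : 'M[S]_2) : \det B = B 0 0 * B 1 1 - B 0 1 * B 1 0.
  pose f i j := B (inord i) (inord j).
  have BE i j : B i j = f (val i) (val j) by rewrite /f !inord_val.
  rewrite (expand_det_row _ 0) !big_ord_recl big_ord0 /cofactor !det_mx11 !mxE !BE /=.
  by rewrite /bump /=; ring.
rewrite (eq_bigl _ _ incF) -(pair_big_dep xpredT (fun i j : 'I_3 => (i < j)%N)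
  (fun i j => \det (\matrix_(l, l') A (F (i, j) l) (F (i, j) l')))) /=.
under eq_bigr do rewrite big_mkcond sum3E.
rewrite sum3E /= !det2E !mxE !F0 !F1 /=.
by rewrite !(add0r, addr0).
Qed.

Lemma sum_increasing3 A :
  \sum_(f : {ffun 'I_3 -> 'I_3} | increasing f) \det (\matrix_(l, l') A (f l) (f l')) =
  \det A.
Proof.
rewrite (big_pred1 [ffun i => i]).
  by congr (\det _); apply/matrixP => l l'; rewrite !mxE !ffunE.
move=> f; apply/'forall_forallP/eqP => [incf|-> l1 l2]; last first.
  by rewrite !ffunE; apply/implyP.
have f01 : (f 0%R < f 1%R)%N by exact: implyP (incf 0 1) isT.
have f12 : (f 1%R < f 2%R)%N by exact: implyP (incf 1 2) isT.
have f2 := ltn_ord (f 2).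
apply/ffunP => i; rewrite ffunE; apply/val_inj.
have : i = 0 \/ i = 1 \/ i = 2.
  by case: i => [[|[|[|//]]] ?]; [left|right; left|right; right]; apply/val_inj.
case=> [->|[->|->]].
- by suff : nat_of_ord (f 0) = 0%N by []; lia.
- by suff : nat_of_ord (f 1) = 1%N by []; lia.
- by suff : nat_of_ord (f 2) = 2%N by []; lia.
Qed.

End PrincipalMinors.

Lemma tr_ext_power_schur21 (R : realType) m (A : 'M[even_ext R m]_3) :
  let B := map_mx (@even_val R m) A in
  wedge (tr_ext_power 1 B) (tr_ext_power 2 B) - tr_ext_power 3 B = even_val (schur21 A).
Proof.
rewrite /= !tr_ext_power_minors sum_increasing1 sum_increasing2 sum_increasing3 det3E.
by [].
Qed.

(** * The Schur form of a Hermitian bundle *)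

Section TensorForms.
Variables (R : realType) (n : nat).
Local Notation S := (even_ext R (n + n)).

Lemma tensor_form_mul (P Q : 'M[R[i]]_3) (Th : 'I_n -> 'I_n -> 'M[R[i]]_3) :
  tensor_form (fun j k => P *m Th j k *m Q) =
  map_mx (even_scal (n + n)) P *m tensor_form Th *m map_mx (even_scal (n + n)) Q.
Proof.
apply/matrixP => b c; rewrite [RHS]mxE mxE.
transitivity (herm_form (\sum_(d < 3) \sum_(a < 3) (P b a * Q d c) *: \matrix_(j, k) Th j k a d)).
  congr herm_form; apply/matrixP => j k; rewrite mxE [LHS]mxE summxE; apply: eq_bigr => d _.
  rewrite mxE mulr_suml summxE; apply: eq_bigr => a _.
  by rewrite mxE mxE mulrAC.
rewrite herm_form_sum; apply: eq_bigr => d _; rewrite herm_form_sum mxE mulr_suml.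
apply: eq_bigr => a _; rewrite herm_formZ rmorphM mxE mxE mxE.
by rewrite mulrAC.
Qed.

Lemma schur21_tensor_similar (P Q : 'M[R[i]]_3) (Th : 'I_n -> 'I_n -> 'M[R[i]]_3) :
  P *m Q = 1%:M ->
  schur21 (tensor_form (fun j k => P *m Th j k *m Q)) = schur21 (tensor_form Th).
Proof.
move=> PQ; rewrite tensor_form_mul; apply: schur21_similar.
by rewrite -map_mxM PQ map_mx1.
Qed.

Lemma tensor_coefE (Th : 'I_n -> 'I_n -> 'M[R[i]]_3) v j k :
  tensor_coef Th v v j k = bform (Th j k)^T (\row_c v c) (\row_c v c).
Proof.
rewrite bformE mxE exchange_big; apply: eq_bigr => c _; apply: eq_bigr => b _.
by rewrite !mxE; ring.
Qed.

End TensorForms.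

Section HermitianBundle.
Variables (R : realType) (n : nat) (X : complexManifold R n) (E : holVectorBundle X 3).
Variables (h : hermitianMetric E) (a : frames E) (x : X).
Hypothesis ax : frame_dom a x.

Let e := frame a x.

Definition frame_comb (z : 'rV[R[i]]_3) : E x := \sum_(b < 3) z 0 b *: tnth e b.

(** The transpose of [gram] at the point, since vectors of coordinates are rows here. *)
Definition frame_gram : 'M[R[i]]_3 := \matrix_(b, d) h x (tnth e b) (tnth e d).

Lemma metric_frame_comb z w : h x (frame_comb z) (frame_comb w) = bform frame_gram z w.
Proof.
rewrite bformE /frame_comb linear_sumlz; apply: eq_bigr => b _.
rewrite linear_sumr; apply: eq_bigr => d _.
by rewrite linearZl_LR linearZr_LR mxE /=; ring.
Qed.

Lemma coord_frame_comb z c : coord e c (frame_comb z) = z 0 c.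
Proof.
rewrite /frame_comb; under eq_bigr do rewrite (tnth_nth 0).
by rewrite coord_sum_free // (basis_free (frame_basis ax)).
Qed.

Lemma frame_gram_gt0 z : z != 0 -> 0 < qform frame_gram z.
Proof.
move=> z0; rewrite -[qform _ _]/(bform _ _ _) -metric_frame_comb.
apply: neq0_dnorm_gt0; apply: contraNneq z0 => fz0; apply/eqP/rowP => c.
by rewrite -coord_frame_comb fz0 linear0 mxE.
Qed.

Variable i : atlas X.

Lemma curvature_end_frame_comb j k z :
  curvature_end h i a j k (frame_comb z) = frame_comb (z *m (curvature_coef h i a j k x)^T).
Proof.
apply: eq_bigr => b _; rewrite -scaler_suml mxE; congr (_ *: _).
by apply: eq_bigr => c _; rewrite coord_frame_comb [in RHS]mxE mulrC.
Qed.

(** The ['i] of i / (2 pi) is absorbed by [herm_form]; only the positive factor 1 / (2 pi) stays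
    with the coefficients. *)
Lemma curvature_form_tensor :
  map_mx (fun w : ext R (n + n) => ('i / (2 * pi)%:C : R[i]) *: w) (curvature_form h i a x) =
  map_mx (@even_val R (n + n))
    (tensor_form (fun j k => ((2 * pi)%:C : R[i])^-1 *: curvature_coef h i a j k x)).
Proof.
apply/matrixP => b c; rewrite !mxE even_val_herm_form -scalerA; congr (_ *: _).
rewrite scaler_sumr; apply: eq_bigr => j _; rewrite scaler_sumr; apply: eq_bigr => k _.
by rewrite scalerA !mxE.
Qed.

End HermitianBundle.

Theorem theorem0p1 (R : realType) (n : nat) (X : complexManifold R n)
    (E : holVectorBundle X 3) (h : hermitianMetric E) :
  griffiths_semipositive h ->
  positive_on_manifold 3
    (fun (i : atlas X) (a : frames E) (x : X) =>
       wedge (chern_form h 1 i a x) (chern_form h 2 i a x)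
       - chern_form h 3 i a x).
Proof.
move=> h_ge0 i a x ix ax; rewrite /chern_form curvature_form_tensor tr_ext_power_schur21.
(* The rows of [Q] are the coordinates, in the given frame, of an orthonormal basis of the fibre. *)
have [Q Q_unit QH] := orthonormal_basis (frame_gram_gt0 h ax).
set H := frame_gram h a x in QH.
have QinvE : H *m Q ^t* = invmx Q by rewrite -[LHS](mulKmx Q_unit) (mulmxA Q) QH mulmx1.
pose Th j k := ((2 * pi)%:C : R[i])^-1 *: curvature_coef h i a j k x.
(* An endomorphism with matrix [Th j k] in the given frame has matrix [(invmx Q)^T *m Th j k *m Q^T]
   in the orthonormal one; the Schur form does not see this change. *)
have PQ : (invmx Q)^T *m Q^T = 1%:M by rewrite -trmx_mul mulmxV // trmx1.
rewrite -(schur21_tensor_similar Th PQ).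
apply: positive_schur21_tensor => v t.
pose z : 'rV[R[i]]_3 := (\row_c v c) *m Q.
have zE : z ^t* = Q ^t* *m (\row_c v c) ^t* by rewrite /z trmx_mul map_mxM.
have pi0 : 0 <= ((2 * pi)%:C : R[i])^-1.
  by rewrite invr_ge0 lecR mulr_ge0 // pi_ge0.
(* Since [H *m Q ^t*] is [invmx Q], the tensor in the orthonormal frame takes at [(v, t)] the
   Griffiths value, up to 1 / (2 pi), at the vector whose coordinates in the given frame are [z]. *)
have -> : qform (tensor_coef (fun j k => (invmx Q)^T *m Th j k *m Q^T) v v) t =
    ((2 * pi)%:C : R[i])^-1 * \sum_(j < n) \sum_(k < n)
      h x (curvature_end h i a j k (frame_comb a x z)) (frame_comb a x z) * (t 0 j * (t 0 k)^*).
  rewrite -[qform _ _]/(bform _ _ _) bformE mulr_sumr; apply: eq_bigr => j _.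
  rewrite mulr_sumr; apply: eq_bigr => k _.
  rewrite (curvature_end_frame_comb h ax i) metric_frame_comb -/H.
  rewrite tensor_coefE.
  have -> : ((invmx Q)^T *m Th j k *m Q^T)^T = Q *m (Th j k)^T *m (H *m Q ^t*).
    by rewrite QinvE !trmx_mul !trmxK mulmxA.
  have -> : bform (Q *m (Th j k)^T *m (H *m Q ^t*)) (\row_c v c) (\row_c v c) =
      ((2 * pi)%:C : R[i])^-1 * bform H (z *m (curvature_coef h i a j k x)^T) z.
    rewrite /bform zE /z /Th linearZ /= -scalemxAr -scalemxAl -scalemxAr -scalemxAl mxE.
    by rewrite !mulmxA.
  by ring.
rewrite mulr_ge0 //; exact: (h_ge0 i a x ix ax).
Qed.
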